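(* The group $\mathcal{E}$ contains no distortion elements.
   Context: Identify $\mathbb{T}^1=\mathbb{R}/\mathbb{Z}$ with $[0,1)$. An interval exchange transformation is a bijection $f:\mathbb{T}^1\to\mathbb{T}^1$ for which there is a partition of $[0,1)$ into finitely many half-open intervals $[a,b)$ on each of which $f$ is a translation $x\mapsto x+c \pmod 1$. $\mathcal{E}$ is the group of all interval exchange transformations under composition. For a finitely generated group $G$ with finite generating set $S$, an element $f\in G$ is a distortion element if $f$ has infinite order and $\liminf_{n\to\infty}|f^n|_S/n=0$, where $|\cdot|_S$ is word length with respect to $S\cup S^{-1}$. For an arbitrary group $G$, $f\in G$ is a distortion element in $G$ if it is a distortion element in some finitely generated subgroup of $G$. *)

(* Defs.v *)
From Stdlib Require Import Reals Lra Lia List.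
Open Scope R_scope.

(** The circle T^1 = R/Z is identified with [0,1). *)
Definition I01 (x : R) : Prop := 0 <= x < 1.

Definition eqI (f g : R -> R) : Prop := forall x, I01 x -> f x = g x.

Definition add_mod1 (x c : R) : R := frac_part (x + c).

Definition is_IET (f : R -> R) : Prop :=
  (forall x, I01 x -> I01 (f x)) /\
  (forall x y, I01 x -> I01 y -> f x = f y -> x = y) /\
  (forall y, I01 y -> exists x, I01 x /\ f x = y) /\
  exists (n : nat) (a c : nat -> R),
    a 0%nat = 0 /\ a n = 1 /\
    (forall i, (i < n)%nat -> a i < a (S i)) /\
    (forall i x, (i < n)%nat -> a i <= x < a (S i) -> f x = add_mod1 x (c i)).

Definition letter (S : list (R -> R)) (g : R -> R) : Prop :=
  exists s, In s S /\
    (eqI g s \/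
     (forall x, I01 x -> I01 (g x) /\ s (g x) = x /\ g (s x) = x)).

Fixpoint eval_word (w : list (R -> R)) : R -> R :=
  match w with
  | nil => fun x => x
  | g :: w' => fun x => g (eval_word w' x)
  end.

Definition word_len_le (S : list (R -> R)) (h : R -> R) (k : nat) : Prop :=
  exists w, (length w <= k)%nat /\ Forall (letter S) w /\ eqI (eval_word w) h.

Definition in_gen (S : list (R -> R)) (h : R -> R) : Prop :=
  exists k, word_len_le S h k.

Definition fpow (f : R -> R) (n : nat) : R -> R := Nat.iter n f.

Definition infinite_order (f : R -> R) : Prop :=
  forall n, (0 < n)%nat -> ~ eqI (fpow f n) (fun x => x).

(** f is a distortion element of the subgroup generated by the finite set S:
    infinite order and liminf_n |f^n|_S / n = 0 (since |f^n|_S / n >= 0, this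
    says: for every eps > 0, |f^n|_S < eps * n for infinitely many n). *)
Definition distortion_in (S : list (R -> R)) (f : R -> R) : Prop :=
  in_gen S f /\ infinite_order f /\
  forall eps, 0 < eps -> forall N : nat, exists n : nat, (N <= n)%nat /\
    exists k : nat, word_len_le S (fpow f n) k /\ INR k < eps * INR n.

Definition distortion_in_E (f : R -> R) : Prop :=
  exists S : list (R -> R), (forall s, In s S -> is_IET s) /\ distortion_in S f.

(* Main.v *)
Require Import Defs.
From Stdlib Require Import Reals ZArith Arith Lra Lia List.
From Stdlib Require Import Classical IndefiniteDescription.
From Stdlib Require Import FunctionalExtensionality PropExtensionality.
Open Scope R_scope.

(** Two subadditive quantities bound the word length from below: the number of
    discontinuities of a map, and, for an additive [lam : R -> R], the size of
    [lam (g x - x)].  Let [f] have small word length along its powers.  The first quantity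
    forces every discontinuity on an infinite orbit to heal under iteration, so that after
    recutting and regluing the interval at finitely many points [f] becomes an isometry of a
    finite union of arcs and circles, and a power of [f] acts on each component as a
    translation by some [r] modulo its length [l].  If all the ratios are rational, then [f]
    has finite order.  Otherwise choose [lam] with [lam l = 0] and [lam r = 1]: then
    [lam (f^(kn) a - a) = n + O(1)], which contradicts the second bound. *)

(** Neither bound suffices alone. Powers of an irrational rotation have at most two breaks, so
    counting breaks does not see them. Displacements have absolute value below 1, so their size does
    not grow either; only their arithmetic can, since an additive [lam] may be unbounded on [0,1)
    and yet takes finitely many values on the displacements of the generators.

    Breaks can appear and later disappear under iteration, so the gluing of the interval must be
    corrected before [f] looks like an isometry. No conjugating map is built: the relation [glued]
    depends only on tails of orbits, hence is invariant under [f], and the reglued space is seen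
    only through functions on [0,1) that respect it. The coordinate [pos] differs from [x] by
    finitely many values, which is why a statement about rotation in [pos] costs only O(1) when it
    is read as one about [f^n a - a]. *)

(** * Connectedness of intervals, finite sets, iteration *)

(** A supremum argument. [U] carries no topology, so that predicates such as cosets can serve as
    values. *)
Lemma connected_const (U : Type) (phi : R -> U) (c d : R) :
  (forall x, c <= x < d -> exists r, 0 < r /\
     forall e, 0 <= e < r -> x + e < d -> phi (x + e) = phi x) ->
  (forall x, c < x < d -> exists r, 0 < r /\
     forall e, 0 < e < r -> c <= x - e -> phi (x - e) = phi x) ->
  forall x, c <= x < d -> phi x = phi c.
Proof.
  intros HR HL x Hx.
  set (E := fun y => c <= y <= x /\ forall z, c <= z <= y -> phi z = phi c).
  destruct (completeness E) as [s [Hub Hlub]].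
  - exists x. intros y [Hy _]. lra.
  - exists c. split; [lra|]. intros z Hz. replace z with c by lra. reflexivity.
  - assert (Hcs : c <= s).
    { apply Hub. split; [lra|]. intros z Hz. replace z with c by lra. reflexivity. }
    assert (Hsx : s <= x). { apply Hlub. intros y [Hy _]. lra. }
    assert (Hlt : forall z, c <= z < s -> phi z = phi c).
    { intros z Hz. apply NNPP. intro Hn.
      assert (s <= z); [|lra]. apply Hlub. intros y [Hy Hy2].
      apply Rnot_lt_le. intro Hzy. apply Hn, Hy2. lra. }
    assert (Hs : phi s = phi c).
    { destruct (Req_dec s c) as [->|Hne]; [reflexivity|].
      destruct (HL s ltac:(lra)) as [r [Hr Hr2]].
      set (e := Rmin (r/2) (s - c)).
      assert (0 < e /\ e <= r/2 /\ e <= s - c).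
      { unfold e. repeat split; [apply Rmin_glb_lt; lra|apply Rmin_l|apply Rmin_r]. }
      rewrite <- (Hr2 e) by lra. apply Hlt. lra. }
    destruct (Req_dec s x) as [<-|Hne]; [exact Hs|exfalso].
    destruct (HR s ltac:(lra)) as [r [Hr Hr2]].
    set (e := Rmin (r/2) (x - s)).
    assert (0 < e /\ e <= r/2 /\ e <= x - s).
    { unfold e. repeat split; [apply Rmin_glb_lt; lra|apply Rmin_l|apply Rmin_r]. }
    assert (s + e <= s); [|lra]. apply Hub. split; [lra|].
    intros z Hz. destruct (Rlt_dec z s) as [Hzs|Hzs]; [apply Hlt; lra|].
    replace z with (s + (z - s)) by ring. rewrite Hr2 by lra. exact Hs.
Qed.

Lemma list_max_le (A : list R) (a0 x : R) :
  In a0 A -> a0 <= x ->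
  exists a, In a A /\ a <= x /\ forall b, In b A -> b <= x -> b <= a.
Proof.
  revert a0. induction A as [|c A IH]; intros a0 [] Ha0.
  - subst c. destruct (classic (exists a1, In a1 A /\ a1 <= x)) as [[a1 [H1 H2]]|Hn].
    + destruct (IH a1 H1 H2) as [a [Ha [Hax Hm]]].
      destruct (Rle_dec a0 a).
      * exists a. split; [now right|]. split; [easy|]. intros b [<-|Hb] Hbx; [easy|auto].
      * exists a0. split; [now left|]. split; [easy|]. intros b [<-|Hb] Hbx; [lra|].
        specialize (Hm b Hb Hbx). lra.
    + exists a0. split; [now left|]. split; [easy|]. intros b [<-|Hb] Hbx; [lra|].
      exfalso; eauto.
  - destruct (IH a0 H Ha0) as [a [Ha [Hax Hm]]].
    destruct (Rle_dec c x) as [Hc|Hc]; [destruct (Rle_dec c a)|].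
    + exists a. split; [now right|]. split; [easy|]. intros b [<-|Hb] Hbx; [easy|auto].
    + exists c. split; [now left|]. split; [easy|]. intros b [<-|Hb] Hbx; [lra|].
      specialize (Hm b Hb Hbx). lra.
    + exists a. split; [now right|]. split; [easy|]. intros b [<-|Hb] Hbx; [lra|auto].
Qed.

Lemma list_min_gt (A : list R) (x u : R) :
  x < u ->
  exists b, x < b <= u /\ (b = u \/ In b A) /\ forall a, In a A -> x < a -> b <= a.
Proof.
  intro Hxu. induction A as [|c A IH].
  - exists u. split; [lra|]. split; [now left|]. intros a [].
  - destruct IH as [b [Hb [Hi Hm]]].
    destruct (Rlt_dec x c) as [Hc|Hc]; [destruct (Rlt_dec c b)|].
    + exists c. split; [lra|]. split; [right; now left|].
      intros a [<-|Ha] Hxa; [lra|]. specialize (Hm a Ha Hxa). lra.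
    + exists b. split; [lra|]. split; [destruct Hi; [now left|right; now right]|].
      intros a [<-|Ha] Hxa; [lra|auto].
    + exists b. split; [lra|]. split; [destruct Hi; [now left|right; now right]|].
      intros a [<-|Ha] Hxa; [lra|auto].
Qed.

(** Classical comprehension on finite sets. [NoDup] is kept for the edge list that is passed to
    [potential_exists]. *)
Lemma list_sep (U : Type) (P : U -> Prop) (l : list U) :
  exists l', NoDup l' /\ forall x, In x l' <-> In x l /\ P x.
Proof.
  induction l as [|c l [l' [Hnd IH]]].
  - exists nil. split; [constructor|]. simpl. tauto.
  - destruct (classic (P c /\ ~ In c l')) as [[Hc Hn]|Hc].
    + exists (c :: l'). split; [now constructor|].
      intro x. simpl. rewrite IH. intuition (subst; auto).
    + exists l'. split; [exact Hnd|]. intro x. simpl. rewrite IH. split; [tauto|].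
      intros [[<-|Hx] HP]; [|tauto].
      apply IH, NNPP. intro Hn. tauto.
Qed.

Lemma list_union (U V : Type) (P : U -> V -> Prop) (l : list U) :
  (forall u, In u l -> exists m, forall v, P u v -> In v m) ->
  exists m, forall u v, In u l -> P u v -> In v m.
Proof.
  induction l as [|c l IH]; intro H.
  - exists nil. intros u v [].
  - destruct IH as [m Hm]; [intros; apply H; now right|].
    destruct (H c (or_introl eq_refl)) as [m' Hm'].
    exists (m' ++ m). intros u v [<-|Hu] Hv; apply in_or_app; eauto.
Qed.

Lemma list_bound (U : Type) (P : U -> R -> Prop) (l : list U) :
  (forall u r r', P u r -> r <= r' -> P u r') ->
  (forall u, In u l -> exists r, P u r) ->
  exists r, 0 <= r /\ forall u, In u l -> P u r.
Proof.
  intro Hmon. induction l as [|c l IH]; intro H.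
  - exists 0. split; [lra|]. intros u [].
  - destruct IH as [m [Hm0 Hm]]; [intros; apply H; now right|].
    destruct (H c (or_introl eq_refl)) as [m' Hm'].
    exists (Rmax m m'). split; [pose proof (Rmax_l m m'); lra|].
    intros u [<-|Hu]; [apply Hmon with m'|apply Hmon with m]; auto using Rmax_l, Rmax_r.
Qed.

Lemma injective_leaves_list (u : nat -> R) (B : list R) :
  (forall i j, u i = u j -> i = j) ->
  exists K, forall m, (K <= m)%nat -> ~ In (u m) B.
Proof.
  intro Hinj. induction B as [|b B [K HK]].
  - exists 0%nat. intros m _ [].
  - destruct (classic (exists i, u i = b)) as [[i Hi]|Hn].
    + exists (Nat.max K (S i)). intros m Hm [Hb|Hb].
      * assert (i = m) by (apply Hinj; congruence). lia.
      * apply (HK m); [lia|exact Hb].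
    + exists K. intros m Hm [Hb|Hb]; [apply Hn; eauto|apply (HK m); auto].
Qed.

Lemma pigeonhole (u : nat -> R) (l : list R) :
  (forall n, In (u n) l) ->
  exists i j, (i < j <= length l)%nat /\ u i = u j.
Proof.
  intro Hin. apply NNPP. intro Hn.
  assert (Hnd : NoDup (map u (seq 0 (S (length l))))).
  { apply NoDup_map_NoDup_ForallPairs; [|apply seq_NoDup].
    intros i j Hi Hj Hij. apply in_seq in Hi, Hj.
    destruct (Nat.lt_trichotomy i j) as [H|[H|H]]; [|exact H|];
      exfalso; apply Hn; [exists i, j|exists j, i]; (split; [lia|auto]). }
  assert (Hl : (length (map u (seq 0 (S (length l)))) <= length l)%nat).
  { apply NoDup_incl_length; [exact Hnd|]. intros x Hx.
    apply in_map_iff in Hx as [n [<- _]]. apply Hin. }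
  rewrite length_map, length_seq in Hl. lia.
Qed.

Lemma iter_mul (U : Type) (f : U -> U) (a b : nat) (x : U) :
  Nat.iter (a * b) f x = Nat.iter a (Nat.iter b f) x.
Proof.
  induction a as [|a IH]; [reflexivity|].
  simpl. rewrite Nat.iter_add, IH. reflexivity.
Qed.

Lemma iter_fixed (U : Type) (f : U -> U) (a : nat) (x : U) :
  f x = x -> Nat.iter a f x = x.
Proof. intro H. induction a as [|a IH]; simpl; congruence. Qed.

Lemma divide_fact (d n : nat) : (1 <= d <= n)%nat -> Nat.divide d (fact n).
Proof.
  intro H. induction n as [|n IH]; [lia|].
  change (fact (S n)) with (S n * fact n)%nat.
  destruct (Nat.eq_dec d (S n)) as [->|].
  - apply Nat.divide_factor_l.
  - apply Nat.divide_mul_r, IH. lia.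
Qed.

(** * Interval exchanges as invertible pairs; left germs and breaks *)

(** Half-open pieces make every right germ move by translation, so discontinuities show only on the
    left. *)
Definition right_local (f : R -> R) : Prop :=
  forall x, I01 x -> exists r, 0 < r /\
    forall e, 0 <= e < r -> I01 (x + e) /\ f (x + e) = f x + e.

(** [left_germ f x y]: the germ of [0,1) on the left of [x] is translated by [f]
    onto the germ on the left of [y]; left germs live at points of (0,1]. *)
Definition left_germ (f : R -> R) (x y : R) : Prop :=
  exists r, 0 < r /\ forall e, 0 < e < r -> I01 (x - e) /\ f (x - e) = y - e.

(** Any list containing the breaks is allowed, which makes subadditivity a mere concatenation. The
    point 0 always belongs to [B], because it has no left germ. *)
Definition breaks_in (f : R -> R) (B : list R) : Prop :=
  forall x, I01 x -> ~ In x B -> left_germ f x (f x).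

Record iet_pair (f h : R -> R) : Prop := {
  pair_map : forall x, I01 x -> I01 (f x);
  pair_inv : forall x, I01 x -> I01 (h x);
  pair_hf : forall x, I01 x -> h (f x) = x;
  pair_fh : forall x, I01 x -> f (h x) = x;
  pair_rf : right_local f;
  pair_rh : right_local h }.

Lemma iet_pair_sym f h : iet_pair f h -> iet_pair h f.
Proof. intros []. constructor; auto. Qed.

Lemma iet_pair_inj f h x y :
  iet_pair f h -> I01 x -> I01 y -> f x = f y -> x = y.
Proof.
  intros P Hx Hy H. rewrite <- (pair_hf _ _ P x Hx), <- (pair_hf _ _ P y Hy). congruence.
Qed.

Lemma iet_pair_id : iet_pair (fun x => x) (fun x => x).
Proof.
  assert (right_local (fun x => x)).
  { intros x [Hx1 Hx2]. exists (1 - x). split; [lra|].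
    intros e He. split; [split; lra|reflexivity]. }
  constructor; auto.
Qed.

Lemma right_local_comp f g :
  right_local f -> right_local g -> (forall x, I01 x -> I01 (f x)) ->
  right_local (fun x => g (f x)).
Proof.
  intros Hf Hg Hm x Hx.
  destruct (Hf x Hx) as [r [Hr Hr2]]. destruct (Hg (f x) (Hm x Hx)) as [s [Hs Hs2]].
  exists (Rmin r s). split; [apply Rmin_glb_lt; lra|].
  intros e He. pose proof (Rmin_l r s). pose proof (Rmin_r r s).
  destruct (Hr2 e ltac:(lra)) as [H1 ->]. split; [exact H1|].
  apply Hs2. lra.
Qed.

Lemma iet_pair_comp f h g k :
  iet_pair f h -> iet_pair g k -> iet_pair (fun x => g (f x)) (fun x => h (k x)).
Proof.
  intros [] []. constructor; auto.
  - intros x Hx. rewrite pair_hf1; auto.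
  - intros x Hx. rewrite pair_fh0; auto.
  - now apply right_local_comp.
  - now apply right_local_comp.
Qed.

Lemma iter_succ_comm (U : Type) (f : U -> U) n x : Nat.iter n f (f x) = f (Nat.iter n f x).
Proof. induction n as [|n IH]; simpl; congruence. Qed.

Lemma iter_cancel f h n x :
  iet_pair f h -> I01 x -> Nat.iter n h (Nat.iter n f x) = x.
Proof.
  intros P. revert x. induction n as [|n IH]; intros x Hx; [reflexivity|].
  simpl. rewrite <- !iter_succ_comm. rewrite iter_succ_comm, IH by (now apply (pair_map _ _ P)).
  now apply (pair_hf _ _ P).
Qed.

Lemma iet_pair_iter f h n : iet_pair f h -> iet_pair (Nat.iter n f) (Nat.iter n h).
Proof.
  intro P. induction n as [|n IH]; [exact iet_pair_id|].
  pose proof (iet_pair_comp _ _ _ _ IH P) as Q.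
  replace (Nat.iter (S n) h) with (fun x => Nat.iter n h (h x)); [exact Q|].
  apply functional_extensionality. intro x. apply iter_succ_comm.
Qed.

Lemma left_germ_id x : 0 < x <= 1 -> left_germ (fun y => y) x x.
Proof.
  intro Hx. exists x. split; [lra|]. intros e He. split; [split; lra|reflexivity].
Qed.

Lemma breaks_in_id : breaks_in (fun x => x) (0 :: nil).
Proof.
  intros x [Hx1 Hx2] Hn. apply left_germ_id.
  split; [|lra]. destruct Hx1 as [Hx1|Hx1]; [exact Hx1|]. elim Hn. now left.
Qed.

Lemma left_germ_dom f x y : left_germ f x y -> 0 < x <= 1.
Proof.
  intros [r [Hr H]]. split.
  - destruct (H (r/2) ltac:(lra)) as [[H1 _] _]. lra.
  - apply Rnot_lt_le. intro Hx.
    set (e := Rmin (r/2) (x-1)).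
    assert (0 < e /\ e <= r/2 /\ e <= x - 1).
    { unfold e. repeat split; [apply Rmin_glb_lt; lra|apply Rmin_l|apply Rmin_r]. }
    destruct (H e ltac:(lra)) as [[_ H1] _]. lra.
Qed.

Lemma left_germ_fun f x y y' : left_germ f x y -> left_germ f x y' -> y = y'.
Proof.
  intros [r [Hr H]] [s [Hs H']].
  set (e := Rmin (r/2) (s/2)).
  assert (0 < e /\ e <= r/2 /\ e <= s/2).
  { unfold e. repeat split; [apply Rmin_glb_lt; lra|apply Rmin_l|apply Rmin_r]. }
  destruct (H e ltac:(lra)) as [_ H1]. destruct (H' e ltac:(lra)) as [_ H2]. lra.
Qed.

Lemma left_germ_comp f g x y z :
  left_germ f x y -> left_germ g y z -> left_germ (fun t => g (f t)) x z.
Proof.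
  intros [r [Hr H]] [s [Hs H']].
  exists (Rmin r s). split; [apply Rmin_glb_lt; lra|].
  intros e He. pose proof (Rmin_l r s). pose proof (Rmin_r r s).
  destruct (H e ltac:(lra)) as [Hxe ->]. split; [exact Hxe|].
  apply H'. lra.
Qed.

Lemma left_germ_inv f h x y : iet_pair f h -> left_germ f x y -> left_germ h y x.
Proof.
  intros P [r [Hr H]]. exists r. split; [exact Hr|]. intros e He.
  destruct (H e He) as [H1 H2]. rewrite <- H2. split.
  - now apply (pair_map _ _ P).
  - now apply (pair_hf _ _ P).
Qed.

Lemma left_germ_inj f h x x' y :
  iet_pair f h -> left_germ f x y -> left_germ f x' y -> x = x'.
Proof.
  intros P H H'. eapply left_germ_fun; eapply left_germ_inv; eauto.
Qed.

Lemma breaks_in_inv f h B : iet_pair f h -> breaks_in f B -> breaks_in h (map f B).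
Proof.
  intros P HB y Hy Hn.
  apply (left_germ_inv f h); [exact P|].
  pose proof (pair_inv _ _ P y Hy) as Hhy.
  rewrite <- (pair_fh _ _ P y Hy) at 2.
  apply HB; [exact Hhy|]. intro Hin. apply Hn.
  rewrite <- (pair_fh _ _ P y Hy). now apply in_map.
Qed.

Lemma breaks_in_comp f h g B C :
  iet_pair f h -> breaks_in f B -> breaks_in g C ->
  breaks_in (fun x => g (f x)) (B ++ map h C).
Proof.
  intros P HB HC x Hx Hn.
  apply left_germ_comp with (f x).
  - apply HB; [exact Hx|]. intro. apply Hn, in_or_app. now left.
  - apply HC; [now apply (pair_map _ _ P)|]. intro H. apply Hn, in_or_app. right.
    rewrite <- (pair_hf _ _ P x Hx). now apply in_map.
Qed.

(** * Finiteness of displacements and of breaks *)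

Lemma displacement_const f B c d :
  right_local f -> breaks_in f B -> 0 <= c -> d <= 1 ->
  (forall b, In b B -> ~ c < b < d) ->
  forall x, c <= x < d -> f x - x = f c - c.
Proof.
  intros Hf HB Hc Hd Hn x Hx.
  apply (connected_const R (fun x => f x - x) c d); [| |exact Hx].
  - intros z Hz. destruct (Hf z ltac:(split; lra)) as [r [Hr H]].
    exists r. split; [exact Hr|]. intros e He _. destruct (H e He) as [_ ->]. lra.
  - intros z Hz. destruct (HB z ltac:(split; lra)) as [r [Hr H]].
    { intro Hi. now apply (Hn z Hi). }
    exists r. split; [exact Hr|]. intros e He _. destruct (H e He) as [_ ->]. lra.
Qed.

Lemma displacement_finite f B :
  right_local f -> breaks_in f B ->
  exists V, forall x, I01 x -> In (f x - x) V.
Proof.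
  intros Hf HB. exists (map (fun b => f b - b) (0 :: B)). intros x [Hx1 Hx2].
  destruct (list_max_le (0 :: B) 0 x (or_introl eq_refl) Hx1) as [c [Hc [Hcx Hm]]].
  assert (H0c : 0 <= c) by (apply Hm; [now left|lra]).
  destruct (Req_dec c x) as [<-|Hne]; [now apply (in_map (fun b => f b - b))|].
  destruct (list_min_gt B x 1 Hx2) as [u [Hu [_ Hu2]]].
  rewrite (displacement_const f B c u Hf HB H0c); [now apply (in_map (fun b => f b - b))|lra| |lra].
  intros b Hb Hbc. destruct (Rle_dec b x) as [Hbx|Hbx].
  - specialize (Hm b (or_intror Hb) Hbx). lra.
  - specialize (Hu2 b Hb ltac:(lra)). lra.
Qed.

(** Between the last break before [x] and [x] itself [f] is a translation. The point [x] may be a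
    break or 1, so [y] need not be [f x]. *)
Lemma left_germ_exists f B x :
  right_local f -> breaks_in f B -> 0 < x <= 1 -> exists y, left_germ f x y.
Proof.
  intros Hf HB Hx.
  (* Negation turns the search for the largest element of [0 :: B] below [x] into [list_min_gt]. *)
  destruct (list_min_gt (map Ropp (0 :: B)) (- x) 0 ltac:(lra)) as [u [Hu [_ Hu2]]].
  set (c := - u). exists (x + (f c - c)).
  exists (x - c). split; [unfold c; lra|]. intros e He.
  split; [split; unfold c in *; lra|].
  rewrite <- (displacement_const f B c x Hf HB) with (x := x - e); unfold c in *; try lra.
  intros b Hb Hbc. specialize (Hu2 (- b) ltac:(apply in_map; now right) ltac:(lra)). lra.
Qed.

Lemma int_frac_unique (z : Z) (r : R) : 0 <= r < 1 -> frac_part (IZR z + r) = r.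
Proof.
  intro Hr. unfold frac_part.
  replace (Int_part (IZR z + r)) with z; [ring|].
  unfold Int_part. rewrite <- (tech_up (IZR z + r) (z + 1)); [lia| |]; rewrite plus_IZR; lra.
Qed.

Lemma add_mod1_shift x c e :
  0 <= add_mod1 x c + e < 1 -> add_mod1 (x + e) c = add_mod1 x c + e.
Proof.
  unfold add_mod1. intro H.
  rewrite <- (int_frac_unique (Int_part (x + c)) (frac_part (x + c) + e) H).
  f_equal. unfold frac_part. ring.
Qed.

Lemma partition_cell (n : nat) (a : nat -> R) x :
  a 0%nat <= x < a n -> exists i, (i < n)%nat /\ a i <= x < a (S i).
Proof.
  intro Hx. induction n as [|n IH]; [lra|].
  destruct (Rlt_dec x (a n)) as [H|H].
  - destruct (IH ltac:(lra)) as [i [Hi H2]]. exists i. split; [lia|exact H2].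
  - exists n. split; [lia|lra].
Qed.

Lemma partition_range (n : nat) (a : nat -> R) :
  (forall i, (i < n)%nat -> a i < a (S i)) ->
  forall i j, (i <= j <= n)%nat -> a i <= a j.
Proof.
  intros Ha i j. induction j as [|j IH]; intro H.
  - replace i with 0%nat by lia. lra.
  - destruct (Nat.eq_dec i (S j)) as [->|]; [lra|].
    specialize (IH ltac:(lia)). specialize (Ha j ltac:(lia)). lra.
Qed.

(** A translation modulo 1 is discontinuous on [0,1) at the ends of its pieces and where it wraps
    around. Wrapping happens exactly where the value is 0, so the list gets the extra point [h 0],
    and the radii below stop at [1 - f x] or [f x]. *)
Lemma is_IET_pair f :
  is_IET f -> exists h B, iet_pair f h /\ breaks_in f B.
Proof.
  intros [Hm [Hinj [Hsur [n [a [c [Ha0 [Han [Ha Hf]]]]]]]]].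
  destruct (functional_choice (fun y x => I01 y -> I01 x /\ f x = y)) as [h Hh].
  { intro y. destruct (classic (I01 y)) as [Hy|Hy].
    - destruct (Hsur y Hy) as [x Hx]. exists x. auto.
    - exists 0. tauto. }
  assert (Hrange : forall i, (i < n)%nat -> 0 <= a i /\ a (S i) <= 1).
  { intros i Hi. rewrite <- Ha0, <- Han. split; apply partition_range with n; auto; lia. }
  assert (Hrf : right_local f).
  { intros x Hx. destruct (partition_cell n a x) as [i [Hi Hxi]]; [destruct Hx; lra|].
    pose proof (Hrange i Hi). pose proof (Hm x Hx) as [Hfx1 Hfx2].
    exists (Rmin (a (S i) - x) (1 - f x)). split; [apply Rmin_glb_lt; lra|].
    intros e He. pose proof (Rmin_l (a (S i) - x) (1 - f x)).
    pose proof (Rmin_r (a (S i) - x) (1 - f x)).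
    split; [split; lra|]. rewrite (Hf i x Hi Hxi) in *. rewrite (Hf i (x + e) Hi) by lra.
    apply add_mod1_shift. lra. }
  assert (Hhf : forall x, I01 x -> h (f x) = x).
  { intros x Hx. destruct (Hh (f x) (Hm x Hx)). now apply Hinj. }
  exists h, (h 0 :: map a (seq 0 n)). split.
  - constructor; auto.
    + intros x Hx. apply Hh, Hx.
    + intros x Hx. apply Hh, Hx.
    + intros y Hy. destruct (Hh y Hy) as [Hx Hfx].
      destruct (Hrf (h y) Hx) as [r [Hr H]]. exists r. split; [exact Hr|].
      intros e He. destruct (H e He) as [H1 H2]. rewrite Hfx in H2. rewrite <- H2.
      split; [now apply Hm|now apply Hhf].
  - intros x Hx Hn. destruct (partition_cell n a x) as [i [Hi Hxi]]; [destruct Hx; lra|].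
    assert (a i <> x).
    { intro E. apply Hn. right. rewrite <- E. apply in_map, in_seq. lia. }
    assert (f x <> 0).
    { intro E. apply Hn. left. rewrite <- E. now apply Hhf. }
    pose proof (Hrange i Hi). pose proof (Hm x Hx) as [Hfx1 Hfx2].
    exists (Rmin (x - a i) (f x)). split; [apply Rmin_glb_lt; lra|].
    intros e He. pose proof (Rmin_l (x - a i) (f x)).
    pose proof (Rmin_r (x - a i) (f x)).
    split; [split; lra|]. rewrite (Hf i x Hi Hxi) in *. rewrite (Hf i (x - e) Hi) by lra.
    apply (add_mod1_shift x (c i) (- e)). lra.
Qed.

(** * The invariant gluing and the healing of breaks *)

(** [glued f x y]: the germ on the right of [x] and the germ on the left of [y] are
    eventually carried by the iterates of [f] to the two sides of one point.  This is
    the [f]-invariant correction of the gluing [y = x] of the interval. *)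
Definition glued (f : R -> R) (x y : R) : Prop :=
  exists M, forall m, (M <= m)%nat -> left_germ (Nat.iter m f) y (Nat.iter m f x).

Lemma breaks_in_iter f h B n :
  iet_pair f h -> breaks_in f B -> exists C, breaks_in (Nat.iter n f) C.
Proof.
  intros P HB. induction n as [|n [C HC]].
  - exists (0 :: nil). exact breaks_in_id.
  - exists (C ++ map (Nat.iter n h) B).
    apply (breaks_in_comp (Nat.iter n f)); auto using iet_pair_iter.
Qed.

Lemma left_germ_iter_exists f h B n x :
  iet_pair f h -> breaks_in f B -> 0 < x <= 1 -> exists y, left_germ (Nat.iter n f) x y.
Proof.
  intros P HB Hx. destruct (breaks_in_iter f h B n P HB) as [C HC].
  eapply left_germ_exists; eauto. apply (pair_rf _ _ (iet_pair_iter f h n P)).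
Qed.

Lemma left_germ_iter_unbroken f B x n :
  breaks_in f B -> 0 < x <= 1 ->
  (forall i, (i < n)%nat -> I01 (Nat.iter i f x) /\ ~ In (Nat.iter i f x) B) ->
  left_germ (Nat.iter n f) x (Nat.iter n f x).
Proof.
  intros HB Hx. induction n as [|n IH]; intro H.
  - now apply left_germ_id.
  - apply (left_germ_comp (Nat.iter n f) f x (Nat.iter n f x)).
    + apply IH. intros i Hi. apply H. lia.
    + apply HB; apply H; lia.
Qed.

Lemma glued_fun f h x y y' : iet_pair f h -> glued f x y -> glued f x y' -> y = y'.
Proof.
  intros P [M H] [M' H'].
  eapply left_germ_inj; [apply (iet_pair_iter f h (M + M') P)|apply H|apply H']; lia.
Qed.

Lemma glued_inj f h x x' y :
  iet_pair f h -> I01 x -> I01 x' -> glued f x y -> glued f x' y -> x = x'.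
Proof.
  intros P Hx Hx' [M H] [M' H'].
  apply (iet_pair_inj _ _ x x' (iet_pair_iter f h (M + M') P)); auto.
  eapply left_germ_fun; [apply H|apply H']; lia.
Qed.

Lemma glued_dom f x y : glued f x y -> 0 < y <= 1.
Proof. intros [M H]. eapply left_germ_dom, (H M). lia. Qed.

(** With finitely many breaks the germ at [y] has some image under [f^n]; composition and uniqueness
    of left germs identify it. *)
Lemma left_germ_iter_split f h B m n x y z :
  iet_pair f h -> breaks_in f B ->
  left_germ (Nat.iter m f) x y -> left_germ (Nat.iter (n + m) f) x z ->
  left_germ (Nat.iter n f) y z.
Proof.
  intros P HB H1 H2.
  assert (Hy : 0 < y <= 1).
  { eapply left_germ_dom, left_germ_inv; [|exact H1]. exact (iet_pair_iter f h m P). }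
  destruct (left_germ_iter_exists f h B n y P HB Hy) as [z' Hz'].
  pose proof (left_germ_comp _ _ _ _ _ H1 Hz') as H3.
  replace (fun t => Nat.iter n f (Nat.iter m f t)) with (Nat.iter (n + m) f) in H3.
  - rewrite (left_germ_fun _ _ _ _ H2 H3). exact Hz'.
  - apply functional_extensionality. intro t. apply Nat.iter_add.
Qed.

(** This is what makes [f] a local isometry of the reglued interval, also at its breaks. *)
Lemma glued_equivariant f h B k x y y' :
  iet_pair f h -> breaks_in f B -> glued f x y ->
  left_germ (Nat.iter k f) y y' -> glued f (Nat.iter k f x) y'.
Proof.
  intros P HB [M H] Hy. exists M. intros m Hm.
  rewrite <- Nat.iter_add.
  eapply left_germ_iter_split; eauto. apply H. lia.
Qed.

(** After the last break on the orbit of [x] the two sides travel together. Pulling the left germ at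
    [f^M x] back by [f^-M] gives [y]. *)
Lemma glued_exists f h B x M :
  iet_pair f h -> breaks_in f B -> I01 x ->
  (forall m, (M <= m)%nat -> ~ In (Nat.iter m f x) B) -> exists y, glued f x y.
Proof.
  intros P HB Hx H.
  assert (HI : forall m, I01 (Nat.iter m f x)).
  { intro m. now apply (pair_map _ _ (iet_pair_iter f h m P)). }
  assert (Hpos : 0 < Nat.iter M f x <= 1).
  { eapply left_germ_dom, HB; auto. }
  destruct (left_germ_iter_exists h f (map f B) M (Nat.iter M f x)) as [y Hy];
    [now apply iet_pair_sym|eapply breaks_in_inv; eauto|exact Hpos|].
  exists y. exists M. intros m Hm.
  replace m with ((m - M) + M)%nat by lia. rewrite Nat.iter_add.
  replace (Nat.iter ((m - M) + M) f) with (fun t => Nat.iter (m - M) f (Nat.iter M f t))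
    by (apply functional_extensionality; intro t; symmetry; apply Nat.iter_add).
  apply left_germ_comp with (Nat.iter M f x).
  - apply (left_germ_inv (Nat.iter M h)); [|exact Hy].
    apply iet_pair_iter. now apply iet_pair_sym.
  - eapply left_germ_iter_unbroken; eauto.
    intros i Hi. rewrite <- Nat.iter_add. split; [apply HI|apply H; lia].
Qed.

(* If the first break [p] of an infinite orbit is not glued to itself, then [f^n] breaks at
   [p], [f^-1 p], ..., [f^-(n-M) p]. *)
Lemma glued_self_of_few_breaks f h B p :
  iet_pair f h -> breaks_in f B -> I01 p ->
  (forall i j, Nat.iter i h p = Nat.iter j h p -> i = j) ->
  (forall i, (1 <= i)%nat -> ~ In (Nat.iter i h p) B) ->
  (exists M, forall m, (M <= m)%nat -> ~ In (Nat.iter m f p) B) ->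
  (forall M, exists n C, breaks_in (Nat.iter n f) C /\ (length C + M < n)%nat) ->
  forall j, glued f (Nat.iter j h p) (Nat.iter j h p).
Proof.
  intros P HB Hp Hinj Hback [M0 Hfwd] Hfew.
  pose proof (iet_pair_sym _ _ P) as P'.
  assert (HI : forall m, I01 (Nat.iter m h p)).
  { intro m. now apply (pair_map _ _ (iet_pair_iter h f m P')). }
  assert (Hcomb : forall n j, (j <= n)%nat ->
            Nat.iter n f (Nat.iter j h p) = Nat.iter (n - j) f p).
  { intros n j Hj. pose proof (Nat.iter_add (n - j) j R f (Nat.iter j h p)) as E.
    replace (n - j + j)%nat with n in E by lia.
    rewrite E. now rewrite (iter_cancel h f j p P' Hp). }
  assert (Hcomb' : forall n j, (n <= j)%nat ->
            Nat.iter n f (Nat.iter j h p) = Nat.iter (j - n) h p).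
  { intros n j Hj. pose proof (Nat.iter_add n (j - n) R h p) as E.
    replace (n + (j - n))%nat with j in E by lia. rewrite E. now rewrite (iter_cancel h f n _ P'). }
  assert (Hto : forall j, left_germ (Nat.iter j f) (Nat.iter j h p) p \/ j = 0%nat).
  { intros [|j]; [now right|left].
    replace p with (Nat.iter (S j) f (Nat.iter (S j) h p)) at 2
      by (rewrite Hcomb by lia; now rewrite Nat.sub_diag).
    apply (left_germ_iter_unbroken f B); [exact HB| |].
    - eapply left_germ_dom. apply HB; [apply HI|apply Hback; lia].
    - intros i Hi. rewrite Hcomb' by lia. split; [apply HI|apply Hback; lia]. }
  destruct (glued_exists f h B p M0 P HB Hp Hfwd) as [y Hy].
  assert (Hyp : y = p).
  { apply NNPP. intro Hne. destruct Hy as [M Hy].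
    destruct (Hfew M) as [n [C [HC Hlen]]].
    assert (Hincl : incl (map (fun j => Nat.iter j h p) (seq 0 (n - M))) C).
    { intros x Hx. apply in_map_iff in Hx as [j [<- Hj]]. apply in_seq in Hj.
      apply NNPP. intro Hx. pose proof (HC _ (HI j) Hx) as Hg.
      (* Here [n - j >= M], so [f^(n-j)] carries the left germ at [y] to [f^(n-j) p]. If [f^n] were
         unbroken at [f^-j p], the left germ at [p] would go to the same place, and injectivity
         would give [y = p]. *)
      rewrite Hcomb in Hg by lia. apply Hne.
      apply (left_germ_inj _ _ _ _ (Nat.iter (n - j) f p) (iet_pair_iter f h (n - j) P)).
      - apply Hy. lia.
      - destruct (Hto j) as [Ht| ->].
        + apply (left_germ_iter_split f h B j (n - j) (Nat.iter j h p)); auto.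
          now replace (n - j + j)%nat with n by lia.
        + rewrite Nat.sub_0_r in *. exact Hg. }
    apply NoDup_incl_length in Hincl.
    - rewrite length_map, length_seq in Hincl. lia.
    - apply NoDup_map_NoDup_ForallPairs; [|apply seq_NoDup].
      intros i j _ _ E. now apply Hinj. }
  subst y. intro j. destruct (Hto j) as [Ht| ->]; [|exact Hy].
  destruct Hy as [M Hy]. exists (M + j)%nat. intros m Hm.
  rewrite Hcomb by lia.
  replace (Nat.iter m f) with (fun t => Nat.iter (m - j) f (Nat.iter j f t)).
  - apply left_germ_comp with p; [exact Ht|apply Hy; lia].
  - apply functional_extensionality. intro t. rewrite <- Nat.iter_add. f_equal. lia.
Qed.

Lemma iter_periodic_mod (U : Type) (f : U -> U) m i x :
  (0 < m)%nat -> Nat.iter m f x = x -> Nat.iter i f x = Nat.iter (i mod m) f x.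
Proof.
  intros Hm H. transitivity (Nat.iter (i mod m + i / m * m) f x).
  - f_equal. pose proof (Nat.div_mod_eq i m). lia.
  - now rewrite Nat.iter_add, iter_mul, (iter_fixed _ (Nat.iter m f)).
Qed.

Lemma iter_aperiodic_inj f h x i j :
  iet_pair f h -> I01 x -> (forall m, (0 < m)%nat -> Nat.iter m f x <> x) ->
  Nat.iter i f x = Nat.iter j f x -> i = j.
Proof.
  intros P Hx Hap.
  assert (W : forall i j, (i < j)%nat -> Nat.iter i f x <> Nat.iter j f x).
  { intros a b Hab E. apply (Hap (b - a)%nat); [lia|].
    apply (iet_pair_inj _ _ _ _ (iet_pair_iter f h a P)); [|exact Hx|].
    - now apply (pair_map _ _ (iet_pair_iter f h (b - a) P)).
    - rewrite <- Nat.iter_add. replace (a + (b - a))%nat with b by lia. congruence. }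
  intro E. destruct (Nat.lt_trichotomy i j) as [H|[H|H]]; [|exact H|]; exfalso.
  - now apply (W i j).
  - now apply (W j i).
Qed.

(** A point whose orbit avoids [B] is glued to itself, so only backward orbits of points of [B]
    matter. A periodic one is finite; on an infinite one all points far enough back are glued to
    themselves. *)
Lemma glued_self_off_list f h B :
  iet_pair f h -> breaks_in f B ->
  (forall M, exists n C, breaks_in (Nat.iter n f) C /\ (length C + M < n)%nat) ->
  exists Q, forall x, I01 x -> ~ In x Q -> glued f x x.
Proof.
  intros P HB Hfew. pose proof (iet_pair_sym _ _ P) as P'.
  assert (Hb : forall b, In b B -> exists Q, forall x,
             (I01 x /\ (exists m, Nat.iter m f x = b) /\ ~ glued f x x) -> In x Q).
  { intros b _. destruct (classic (I01 b)) as [Ib|Nb].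
    2:{ exists nil. intros x [Hx [[m Hm] _]]. exfalso. apply Nb. rewrite <- Hm.
        now apply (pair_map _ _ (iet_pair_iter f h m P)). }
    assert (Hback : forall x m, I01 x -> Nat.iter m f x = b -> x = Nat.iter m h b).
    { intros x m Hx <-. now rewrite (iter_cancel f h m x P Hx). }
    destruct (classic (exists m, (0 < m)%nat /\ Nat.iter m h b = b)) as [[m [Hm Hper]]|Hap].
    - exists (map (fun i => Nat.iter i h b) (seq 0 m)).
      intros x [Hx [[i Hi] _]]. rewrite (Hback x i Hx Hi).
      rewrite (iter_periodic_mod _ h m i b Hm Hper).
      apply (in_map (fun i => Nat.iter i h b)), in_seq.
      pose proof (Nat.mod_upper_bound i m). lia.
    - assert (Hinjh : forall i j, Nat.iter i h b = Nat.iter j h b -> i = j).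
      { intros i j. apply (iter_aperiodic_inj h f); auto. intros m Hm E. apply Hap. eauto. }
      assert (Hinjf : forall i j, Nat.iter i f b = Nat.iter j f b -> i = j).
      { intros i j. apply (iter_aperiodic_inj f h); auto. intros m Hm E. apply Hap.
        exists m. split; [exact Hm|]. rewrite <- E at 1. now apply (iter_cancel f h). }
      destruct (injective_leaves_list (fun i => Nat.iter i h b) B Hinjh) as [K HK].
      destruct (injective_leaves_list (fun i => Nat.iter i f b) B Hinjf) as [M HM].
      (* Every point of [B] on this orbit lies strictly forward of [p], so the backward orbit of [p]
         is harmless and fewer than [K] steps back from [b] remain as exceptions. *)
      set (p := Nat.iter K h b).
      assert (Hp : I01 p) by now apply (pair_map _ _ (iet_pair_iter h f K P')).
      assert (HG : forall j, glued f (Nat.iter j h p) (Nat.iter j h p)).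
      { apply (glued_self_of_few_breaks f h B p P HB Hp); [| | |exact Hfew].
        - intros i j. unfold p. rewrite <- !Nat.iter_add. intro E. apply Hinjh in E. lia.
        - intros i Hi. unfold p. rewrite <- Nat.iter_add. apply HK. lia.
        - exists (M + K)%nat. intros m Hm. unfold p.
          replace m with ((m - K) + K)%nat by lia. rewrite Nat.iter_add.
          rewrite (iter_cancel h f K b P' Ib). apply HM. lia. }
      exists (map (fun i => Nat.iter i h b) (seq 0 K)).
      intros x [Hx [[i Hi] Hng]]. rewrite (Hback x i Hx Hi) in *.
      apply (in_map (fun i => Nat.iter i h b)), in_seq. split; [lia|].
      apply Nat.nle_gt. intro Hle. apply Hng.
      replace i with ((i - K) + K)%nat by lia. rewrite Nat.iter_add. apply HG. }
  destruct (list_union R R _ B Hb) as [Q HQ].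
  exists Q. intros x Hx Hn. apply NNPP. intro Hng. apply Hn.
  destruct (classic (exists m, In (Nat.iter m f x) B)) as [[m Hm]|Hno].
  - apply (HQ _ x Hm). eauto.
  - exfalso. apply Hng. exists 0%nat. intros m _.
    assert (HI : forall m, I01 (Nat.iter m f x)).
    { intro i. now apply (pair_map _ _ (iet_pair_iter f h i P)). }
    apply (left_germ_iter_unbroken f B); [exact HB| |].
    + eapply left_germ_dom, HB; [exact Hx|]. intro H0. apply Hno. now exists 0%nat.
    + intros i _. split; [apply HI|]. intro. apply Hno. eauto.
Qed.

(** * Charts of the reglued interval *)

(* A partial injection on a finite set decomposes into paths and cycles: prescribed
   increments along the edges integrate exactly on a path, and modulo the total increment
   [len] on a cycle.  Edges are added one at a time; [len] can only become nonzero on a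
   component without source or sink. *)
Lemma potential_exists (w : R -> R -> R) (L : list (R * R)) :
  NoDup (map fst L) -> NoDup (map snd L) ->
  exists comp t len : R -> R,
    (forall b y, In (b, y) L -> comp b = comp y /\
       exists m : Z, t y = t b + w b y + IZR m * len (comp b)) /\
    (forall y, len (comp y) <> 0 -> In y (map fst L) /\ In y (map snd L)) /\
    (forall y z, comp y = comp z -> ~ In y (map fst L) -> ~ In z (map fst L) -> y = z) /\
    (forall y z, comp y = comp z -> ~ In y (map snd L) -> ~ In z (map snd L) -> y = z).
Proof.
  induction L as [|[a x] L IH]; intros H1 H2.
  - exists (fun x => x), (fun _ => 0), (fun _ => 0).
    repeat split; simpl in *; auto; tauto.
  - simpl in H1, H2. apply NoDup_cons_iff in H1 as [Ha H1], H2 as [Hx H2].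
    destruct (IH H1 H2) as [comp [t [len [He [Hlen [Hsrc Hsnk]]]]]]. clear IH.
    assert (La : len (comp a) = 0).
    { apply NNPP. intro H. apply Hlen in H. tauto. }
    assert (Lx : len (comp x) = 0).
    { apply NNPP. intro H. apply Hlen in H. tauto. }
    destruct (Req_dec (comp a) (comp x)) as [Hc|Hc].
    + set (d := t x - t a - w a x).
      set (len' := fun c => if Req_dec_T c (comp a) then d else len c).
      exists comp, t, len'. repeat split.
      * destruct H as [E|H]; [injection E as <- <-; exact Hc|now apply He].
      * destruct H as [E|H].
        -- injection E as <- <-. exists 1%Z. unfold len'.
           destruct (Req_dec_T (comp a) (comp a)); [unfold d; ring|easy].
        -- destruct (He b y H) as [_ [m Hm]]. unfold len'.
           destruct (Req_dec_T (comp b) (comp a)) as [E|E]; [|now exists m].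
           exists 0%Z. rewrite Hm, E, La. ring.
      * revert H. unfold len'. destruct (Req_dec_T (comp y) (comp a)) as [E|E]; intro H.
        -- simpl. apply NNPP. intro Hn. apply Hn. left. symmetry. apply (Hsrc y a E); tauto.
        -- right. now apply Hlen.
      * revert H. unfold len'. destruct (Req_dec_T (comp y) (comp a)) as [E|E]; intro H.
        -- simpl. apply NNPP. intro Hn. apply Hn. left. symmetry.
           apply (Hsnk y x); [congruence| |]; tauto.
        -- right. now apply Hlen.
      * simpl. intros y z E Hy Hz. apply Hsrc; tauto.
      * simpl. intros y z E Hy Hz. apply Hsnk; tauto.
    + set (comp' := fun y => if Req_dec_T (comp y) (comp x) then comp a else comp y).
      set (t' := fun y => if Req_dec_T (comp y) (comp x)
                          then t y + (t a + w a x - t x) else t y).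
      assert (Hlen' : forall y, len (comp' y) = len (comp y)).
      { intro y. unfold comp'. destruct (Req_dec_T (comp y) (comp x)) as [->|]; lra. }
      exists comp', t', len. repeat split.
      * destruct H as [E|H].
        -- injection E as <- <-. unfold comp'.
           destruct (Req_dec_T (comp a) (comp x)), (Req_dec_T (comp x) (comp x)); easy.
        -- destruct (He b y H) as [E _]. unfold comp'. now rewrite E.
      * destruct H as [E|H].
        -- injection E as <- <-. exists 0%Z. unfold t'.
           destruct (Req_dec_T (comp a) (comp x)), (Req_dec_T (comp x) (comp x)); try easy.
           ring.
        -- destruct (He b y H) as [E [m Hm]]. exists m. rewrite Hlen'. unfold t'.
           rewrite <- E. destruct (Req_dec_T (comp b) (comp x)); lra.
      * right. apply (Hlen y). now rewrite <- Hlen'.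
      * right. apply (Hlen y). now rewrite <- Hlen'.
      * intros y z. simpl. unfold comp'.
        destruct (Req_dec_T (comp y) (comp x)) as [Ey|Ey],
                 (Req_dec_T (comp z) (comp x)) as [Ez|Ez]; intros E Hy Hz.
        -- apply Hsrc; [congruence| |]; tauto.
        -- exfalso. apply Hz. left. apply Hsrc; [congruence| |]; tauto.
        -- exfalso. apply Hy. left. symmetry. apply Hsrc; [congruence| |]; tauto.
        -- apply Hsrc; [congruence| |]; tauto.
      * intros y z. simpl. unfold comp'.
        destruct (Req_dec_T (comp y) (comp x)) as [Ey|Ey],
                 (Req_dec_T (comp z) (comp x)) as [Ez|Ez]; intros E Hy Hz.
        -- apply Hsnk; [congruence| |]; tauto.
        -- exfalso. apply Hy. left. apply Hsnk; [congruence| |]; tauto.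
        -- exfalso. apply Hz. left. apply Hsnk; [congruence| |]; tauto.
        -- apply Hsnk; [congruence| |]; tauto.
Qed.

(** Local constancy in the reglued topology: the left neighbourhood of [x] is taken at its partner
    [y]. [U] is arbitrary because both [len] and cosets of drifts are used as [phi]. *)
Definition locally_const (f : R -> R) (U : Type) (phi : R -> U) : Prop :=
  (forall x, I01 x -> exists r, 0 < r /\
     forall e, 0 <= e < r -> I01 (x + e) -> phi (x + e) = phi x) /\
  (forall x y, I01 x -> glued f x y -> exists r, 0 < r /\
     forall e, 0 < e < r -> I01 (y - e) -> phi (y - e) = phi x).

(** The interval, recut and reglued along [glued f], is a finite union of arcs and circles;
    [pos] is an arc-length coordinate, defined modulo [len], and [cell] picks a point of the
    finite set [A] in the same connected component. *)
Record chart (f : R -> R) (A T : list R) (cell pos len : R -> R) : Prop := {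
  chart_cell : forall x, I01 x -> In (cell x) A /\ I01 (cell x);
  chart_const : forall (U : Type) (phi : R -> U), locally_const f U phi ->
    forall x, I01 x -> phi x = phi (cell x);
  chart_len : locally_const f R len;
  chart_right : forall x, I01 x -> exists r, 0 < r /\
     forall e, 0 <= e < r -> I01 (x + e) -> pos (x + e) = pos x + e;
  chart_left : forall x y, I01 x -> glued f x y -> exists r, 0 < r /\
     forall e, 0 < e < r -> I01 (y - e) -> exists m : Z, pos (y - e) = pos x - e + IZR m * len x;
  chart_shift : forall x, I01 x -> In (pos x - x) T }.

(** Cut [0,1) into cells at 0, at [Q] and at the partners of [Q]. Interior points of cells are glued
    to themselves, and the gluing at cut points is a partial injection between right and left ends
    of cells. [potential_exists] then shifts each cell by a constant [t], so [pos x - x] has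
    finitely many values. *)
Lemma chart_exists f h Q :
  iet_pair f h -> (forall x, I01 x -> ~ In x Q -> glued f x x) ->
  exists A T cell pos len, chart f A T cell pos len.
Proof.
  intros P HQ.
  destruct (list_union R R (glued f) Q) as [Y HY].
  { intros q _. destruct (classic (exists y, glued f q y)) as [[y Hy]|Hn].
    - exists (y :: nil). intros v Hv. left. eapply glued_fun; eauto.
    - exists nil. intros v Hv. apply Hn. eauto. }
  (* Including the partners [Y] ensures that what is glued to a cut point is the right end of a
     whole cell. *)
  destruct (list_sep R I01 (0 :: Q ++ Y)) as [A [_ HA]].
  assert (H0 : In 0 A) by (apply HA; split; [now left|split; lra]).
  assert (HAI : forall a, In a A -> I01 a) by (intros a Ha; now apply HA).
  destruct (functional_choice (fun x a => I01 x ->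
      In a A /\ a <= x /\ forall b, In b A -> b <= x -> b <= a)) as [cell Hcell].
  { intro x. destruct (classic (I01 x)) as [Hx|]; [|exists 0; tauto].
    destruct (list_max_le A 0 x H0 (proj1 Hx)) as [a Ha]. exists a. auto. }
  destruct (functional_choice (fun x b => x < 1 ->
      x < b <= 1 /\ (b = 1 \/ In b A) /\ forall a, In a A -> x < a -> b <= a)) as [next Hnext].
  { intro x. destruct (classic (x < 1)) as [Hx|]; [|exists 0; tauto].
    destruct (list_min_gt A x 1 Hx) as [b Hb]. exists b. auto. }
  assert (cell_eq : forall a x, In a A -> a <= x < next a -> cell x = a).
  { intros a x Ha Hax. pose proof (HAI a Ha) as [Ha0 Ha1].
    destruct (Hnext a Ha1) as [Hn1 [_ Hn2]].
    destruct (Hcell x ltac:(split; lra)) as [Hc1 [Hc2 Hc3]].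
    specialize (Hc3 a Ha ltac:(lra)).
    destruct (Rle_lt_or_eq_dec _ _ Hc3) as [Hlt|]; [|auto].
    specialize (Hn2 _ Hc1 Hlt). lra. }
  assert (cell_next : forall x, I01 x -> cell x <= x < next (cell x)).
  { intros x Hx. destruct (Hcell x Hx) as [Hc1 [Hc2 Hc3]]. split; [exact Hc2|].
    destruct Hx as [Hx0 Hx1]. destruct (Hnext (cell x) ltac:(lra)) as [Hn1 [[->|Hn2] _]]; [lra|].
    apply Rnot_le_lt. intro H. specialize (Hc3 _ Hn2 H). lra. }
  assert (glue_cases : forall x y, I01 x -> glued f x y ->
            (y = x /\ ~ In x A) \/ (In x A /\ exists a, In a A /\ a < y /\ next a = y)).
  { intros x y Hx Hg. pose proof (glued_dom f x y Hg) as Hy.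
    destruct (classic (In x A)) as [HxA|HxA]; [right|left].
    - split; [exact HxA|].
      assert (HyA : y = 1 \/ In y A).
      { destruct (classic (In x Q)) as [HxQ|HxQ].
        - destruct (Req_dec y 1) as [|Hne]; [now left|right].
          apply HA. split; [right; apply in_or_app; right; now apply (HY x)|].
          split; [lra|]. destruct Hy as [_ [Hy|Hy]]; [exact Hy|easy].
        - right. now rewrite (glued_fun f h x y x P Hg (HQ x Hx HxQ)). }
      destruct (list_sep R (fun a => a < y) A) as [A' [_ HA']].
      destruct (list_max_le A' 0 y) as [a [Ha1 [Ha2 Ha3]]];
        [apply HA'; split; [exact H0|lra]|lra|].
      apply HA' in Ha1 as [Ha1 Hay]. exists a. split; [exact Ha1|]. split; [exact Hay|].
      destruct (Hnext a ltac:(apply HAI; exact Ha1)) as [Hn1 [Hn2 Hn3]].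
      assert (next a <= y) by (destruct HyA as [->|HyA]; [lra|now apply Hn3]).
      destruct (Rle_lt_or_eq_dec _ _ H) as [Hlt|]; [|easy].
      destruct Hn2 as [Hn2|Hn2]; [lra|].
      specialize (Ha3 (next a)). rewrite HA' in Ha3. specialize (Ha3 (conj Hn2 Hlt) H). lra.
    - split; [|exact HxA]. apply (glued_fun f h x y x P Hg), HQ; [exact Hx|].
      intro HxQ. apply HxA, HA. split; [right; apply in_or_app; now left|exact Hx]. }
  destruct (list_sep (R * R) (fun e => glued f (snd e) (next (fst e))) (list_prod A A))
    as [L [HLnd HL]].
  assert (HL' : forall a x, In (a, x) L <-> (In a A /\ In x A) /\ glued f x (next a)).
  { intros a x. rewrite HL. simpl. now rewrite in_prod_iff. }
  (* An edge from [a] to [x] says that the cell of [x] continues the cell of [a]. The weight is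
     chosen so that [next a + t a] and [x + t x], the coordinates of the two glued ends, agree
     modulo [len]. *)
  destruct (potential_exists (fun a x => next a - x) L) as [comp [t [len [He _]]]].
  { apply NoDup_map_NoDup_ForallPairs; [|exact HLnd].
    intros [a x] [a' x'] Hi Hi'. simpl. intros <-. apply HL' in Hi, Hi'.
    f_equal. apply (glued_inj f h x x' (next a) P); try tauto; apply HAI; tauto. }
  { apply NoDup_map_NoDup_ForallPairs; [|exact HLnd].
    intros [a x] [a' x'] Hi Hi'. simpl. intros <-. apply HL' in Hi, Hi'.
    destruct Hi as [[Ha _] Hg], Hi' as [[Ha' _] Hg'].
    pose proof (glued_fun f h _ _ _ P Hg Hg') as E. f_equal.
    pose proof (Hnext a (proj2 (HAI a Ha))) as [Hn _].
    pose proof (Hnext a' (proj2 (HAI a' Ha'))) as [Hn' _].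
    pose proof (Rmax_l a a'). pose proof (Rmax_r a a').
    assert (Rmax a a' < next a) by (apply Rmax_lub_lt; lra).
    transitivity (cell (Rmax a a')); [symmetry|]; apply cell_eq; auto; lra. }
  assert (left_side : forall x y, I01 x -> glued f x y -> exists r, 0 < r /\
     forall e, 0 < e < r -> comp (cell (y - e)) = comp (cell x) /\
       exists m : Z, y - e + t (cell (y - e)) =
                     x + t (cell x) - e + IZR m * len (comp (cell x))).
  { intros x y Hx Hg. destruct (glue_cases x y Hx Hg) as [[-> HxA]|[HxA [a [Ha [Hay E]]]]].
    - destruct (cell_next x Hx) as [Hc1 Hc2]. pose proof (Hcell x Hx) as [HcA _].
      assert (cell x <> x) by congruence.
      exists (x - cell x). split; [lra|]. intros e Hee.
      rewrite (cell_eq (cell x) (x - e)); [|exact HcA|lra].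
      split; [reflexivity|]. exists 0%Z. ring.
    - exists (y - a). split; [lra|]. intros e Hee.
      rewrite (cell_eq a (y - e)); [|exact Ha|lra].
      rewrite (cell_eq x x HxA); [|destruct (Hnext x (proj2 Hx)); lra].
      destruct (He a x) as [Hc [m Hm]]; [apply HL'; rewrite E; tauto|].
      split; [exact Hc|]. exists (- m)%Z. rewrite opp_IZR, Hm, <- Hc, E. ring. }
  assert (right_side : forall x, I01 x -> exists r, 0 < r /\
     forall e, 0 <= e < r -> cell (x + e) = cell x).
  { intros x Hx. destruct (cell_next x Hx) as [Hc1 Hc2].
    exists (next (cell x) - x). split; [lra|]. intros e Hee.
    apply cell_eq; [now apply Hcell|lra]. }
  exists A, (map t A), cell, (fun x => x + t (cell x)), (fun x => len (comp (cell x))).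
  constructor.
  - intros x Hx. split; [|apply HAI]; now apply Hcell.
  - intros U phi [Hr Hl] x Hx.
    pose proof (cell_next x Hx) as Hc. pose proof (Hcell x Hx) as [HcA _].
    pose proof (HAI _ HcA) as [Hc0 Hc1].
    destruct (Hnext (cell x) Hc1) as [Hn1 [_ Hn2]].
    apply (connected_const U phi (cell x) (next (cell x))); [| |exact Hc].
    + intros z Hz. destruct (Hr z ltac:(split; lra)) as [r [Hr0 Hr1]].
      exists r. split; [exact Hr0|]. intros e Hee Hlt. apply Hr1; [exact Hee|split; lra].
    + intros z Hz. assert (Iz : I01 z) by (split; lra).
      destruct (Hl z z Iz) as [r [Hr0 Hr1]].
      { apply HQ; [exact Iz|]. intro HzQ.
        assert (In z A) by (apply HA; split; [right; apply in_or_app; now left|exact Iz]).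
        specialize (Hn2 z H ltac:(lra)). lra. }
      exists r. split; [exact Hr0|]. intros e Hee Hlt. apply Hr1; [exact Hee|split; lra].
  - split.
    + intros x Hx. destruct (right_side x Hx) as [r [Hr0 Hr1]].
      exists r. split; [exact Hr0|]. intros e Hee _. now rewrite Hr1.
    + intros x y Hx Hg. destruct (left_side x y Hx Hg) as [r [Hr0 Hr1]].
      exists r. split; [exact Hr0|]. intros e Hee _. f_equal. now apply Hr1.
  - intros x Hx. destruct (right_side x Hx) as [r [Hr0 Hr1]].
    exists r. split; [exact Hr0|]. intros e Hee _. rewrite Hr1 by exact Hee. ring.
  - intros x y Hx Hg. destruct (left_side x y Hx Hg) as [r [Hr0 Hr1]].
    exists r. split; [exact Hr0|]. intros e Hee _. now apply Hr1.
  - intros x Hx. replace (x + t (cell x) - x) with (t (cell x)) by ring.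
    apply in_map. now apply Hcell.
Qed.

(** * Recurrence of components and linear drift *)

Lemma locally_const_iter f h B k (U : Type) (phi : R -> U) :
  iet_pair f h -> breaks_in f B -> locally_const f U phi ->
  locally_const f U (fun x => phi (Nat.iter k f x)).
Proof.
  intros P HB [Hr Hl]. pose proof (iet_pair_iter f h k P) as Pk. split.
  - intros x Hx. destruct (pair_rf _ _ Pk x Hx) as [r [Hr0 Hr1]].
    destruct (Hr (Nat.iter k f x) (pair_map _ _ Pk x Hx)) as [s [Hs0 Hs1]].
    exists (Rmin r s). split; [apply Rmin_glb_lt; lra|].
    intros e He HI. pose proof (Rmin_l r s). pose proof (Rmin_r r s).
    destruct (Hr1 e ltac:(lra)) as [_ E]. rewrite E.
    apply Hs1; [lra|]. rewrite <- E. now apply (pair_map _ _ Pk).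
  - intros x y Hx Hg.
    destruct (left_germ_iter_exists f h B k y P HB (glued_dom f x y Hg)) as [y' Hy'].
    destruct (Hl _ y' (pair_map _ _ Pk x Hx)) as [s [Hs0 Hs1]].
    { eapply glued_equivariant; eauto. }
    destruct Hy' as [r [Hr0 Hr1]].
    exists (Rmin r s). split; [apply Rmin_glb_lt; lra|].
    intros e He HI. pose proof (Rmin_l r s). pose proof (Rmin_r r s).
    destruct (Hr1 e ltac:(lra)) as [_ E]. rewrite E.
    apply Hs1; [lra|]. rewrite <- E. now apply (pair_map _ _ Pk).
Qed.

Lemma eventually_periodic (g : R -> R) (A l : list R) :
  (forall a, In a l -> forall n, In (Nat.iter n g a) A) ->
  exists N k, (0 < k)%nat /\ forall a, In a l -> forall n, (N <= n)%nat ->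
    Nat.iter (k + n) g a = Nat.iter n g a.
Proof.
  induction l as [|c l IH]; intro H.
  - exists 0%nat, 1%nat. split; [lia|]. intros a [].
  - destruct IH as [N [k [Hk HN]]]; [intros; apply H; now right|].
    destruct (pigeonhole (fun n => Nat.iter n g c) A) as [i [j [Hij E]]];
      [apply H; now left|].
    exists (N + i)%nat, (k * (j - i))%nat. split; [nia|].
    assert (Hmul : forall a k0 M, (forall n, (M <= n)%nat ->
              Nat.iter (k0 + n) g a = Nat.iter n g a) ->
              forall q n, (M <= n)%nat -> Nat.iter (q * k0 + n) g a = Nat.iter n g a).
    { intros a k0 M Hper q n Hn. induction q as [|q IHq]; [reflexivity|].
      replace (S q * k0 + n)%nat with (k0 + (q * k0 + n))%nat by lia.
      rewrite Hper by lia. exact IHq. }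
    intros a [<-|Ha] n Hn.
    + apply (Hmul c (j - i)%nat i); [|lia]. intros m Hm.
      replace (j - i + m)%nat with ((m - i) + j)%nat by lia.
      rewrite Nat.iter_add, <- E, <- Nat.iter_add. f_equal. lia.
    + rewrite Nat.mul_comm. apply (Hmul a k N); [|lia]. now apply HN.
Qed.

(** Locally constant functions see [f] only through the self-map [g] of a finite set of cells, so
    one [k] serves all of them. The map [g] is only known to be eventually periodic; its preperiod
    [N] is absorbed by writing each point as [f^N] of another one. *)
Lemma recurrence_power f h B A T cell pos len :
  iet_pair f h -> breaks_in f B -> chart f A T cell pos len ->
  exists k, (0 < k)%nat /\ forall (U : Type) (phi : R -> U), locally_const f U phi ->
    forall x, I01 x -> phi (Nat.iter k f x) = phi x.
Proof.
  intros P HB C. set (g := fun a => cell (f a)).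
  assert (Hg : forall x n, I01 x -> I01 (Nat.iter n g (cell x)) /\ In (Nat.iter n g (cell x)) A).
  { intros x n Hx. induction n as [|n [IH _]].
    - split; now apply (chart_cell _ _ _ _ _ _ C).
    - split; apply (chart_cell _ _ _ _ _ _ C); now apply (pair_map _ _ P). }
  assert (Hfg : forall n (U : Type) (phi : R -> U), locally_const f U phi ->
            forall x, I01 x -> phi (Nat.iter n f x) = phi (Nat.iter n g (cell x))).
  { induction n as [|n IH]; intros U phi Hphi x Hx.
    - now apply (chart_const _ _ _ _ _ _ C).
    - simpl. rewrite (IH U (fun y => phi (f y)) (locally_const_iter f h B 1 U phi P HB Hphi) x Hx).
      apply (chart_const _ _ _ _ _ _ C); [exact Hphi|].
      apply (pair_map _ _ P). now apply Hg. }
  destruct (list_sep R (fun a => exists x, I01 x /\ a = cell x) A) as [l [_ Hl]].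
  destruct (eventually_periodic g A l) as [N [k [Hk HN]]].
  { intros a Ha n. apply Hl in Ha as [_ [x [Hx ->]]]. now apply Hg. }
  exists k. split; [exact Hk|]. intros U phi Hphi y Hy.
  pose proof (iet_pair_iter f h N P) as PN.
  rewrite <- (pair_fh _ _ PN y Hy). set (x := Nat.iter N h y).
  assert (Hx : I01 x) by now apply (pair_inv _ _ PN).
  rewrite <- Nat.iter_add, !(Hfg _ U phi Hphi x Hx), HN; [reflexivity| |lia].
  apply Hl. split; [now apply (chart_cell _ _ _ _ _ _ C)|eauto].
Qed.

Lemma Z_coset_ext (a b l : R) :
  (exists m : Z, a = b + IZR m * l) ->
  (fun s => exists m : Z, s = a + IZR m * l) = (fun s => exists m : Z, s = b + IZR m * l).
Proof.
  intros [m ->]. apply functional_extensionality. intro s. apply propositional_extensionality.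
  split; intros [p ->].
  - exists (m + p)%Z. rewrite plus_IZR. ring.
  - exists (p - m)%Z. rewrite minus_IZR. ring.
Qed.

(** The drift makes sense only modulo [len], so it is stored as its coset, a predicate. Across a
    gluing, [pos] at a point and at its image change by the same amount up to multiples of [len]. *)
Lemma drift_locally_const f h B A T cell pos len k :
  iet_pair f h -> breaks_in f B -> chart f A T cell pos len ->
  (forall x, I01 x -> len (Nat.iter k f x) = len x) ->
  locally_const f (R -> Prop)
    (fun x s => exists m : Z, s = pos (Nat.iter k f x) - pos x + IZR m * len x).
Proof.
  intros P HB C Hlen. pose proof (iet_pair_iter f h k P) as Pk. split.
  - intros x Hx. destruct (pair_rf _ _ Pk x Hx) as [r [Hr0 Hr1]].
    destruct (chart_right _ _ _ _ _ _ C x Hx) as [s [Hs0 Hs1]].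
    destruct (chart_right _ _ _ _ _ _ C _ (pair_map _ _ Pk x Hx)) as [u [Hu0 Hu1]].
    destruct (proj1 (chart_len _ _ _ _ _ _ C) x Hx) as [v [Hv0 Hv1]].
    exists (Rmin (Rmin r s) (Rmin u v)). split; [repeat apply Rmin_glb_lt; lra|].
    intros e He HI. pose proof (Rmin_l (Rmin r s) (Rmin u v)).
    pose proof (Rmin_r (Rmin r s) (Rmin u v)).
    pose proof (Rmin_l r s). pose proof (Rmin_r r s).
    pose proof (Rmin_l u v). pose proof (Rmin_r u v).
    destruct (Hr1 e ltac:(lra)) as [_ E].
    rewrite Hv1 by (auto; lra). apply Z_coset_ext. exists 0%Z.
    rewrite E, Hs1, Hu1; [ring|lra| |lra|exact HI].
    rewrite <- E. now apply (pair_map _ _ Pk).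
  - intros x y Hx Hg.
    destruct (left_germ_iter_exists f h B k y P HB (glued_dom f x y Hg)) as [y' Hy'].
    assert (Hg' : glued f (Nat.iter k f x) y') by (eapply glued_equivariant; eauto).
    destruct (chart_left _ _ _ _ _ _ C x y Hx Hg) as [s [Hs0 Hs1]].
    destruct (chart_left _ _ _ _ _ _ C _ y' (pair_map _ _ Pk x Hx) Hg') as [u [Hu0 Hu1]].
    destruct (proj2 (chart_len _ _ _ _ _ _ C) x y Hx Hg) as [v [Hv0 Hv1]].
    destruct Hy' as [r [Hr0 Hr1]].
    exists (Rmin (Rmin r s) (Rmin u v)). split; [repeat apply Rmin_glb_lt; lra|].
    intros e He HI. pose proof (Rmin_l (Rmin r s) (Rmin u v)).
    pose proof (Rmin_r (Rmin r s) (Rmin u v)).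
    pose proof (Rmin_l r s). pose proof (Rmin_r r s).
    pose proof (Rmin_l u v). pose proof (Rmin_r u v).
    destruct (Hr1 e ltac:(lra)) as [_ E].
    rewrite Hv1 by (auto; lra). apply Z_coset_ext.
    destruct (Hs1 e ltac:(lra) HI) as [m1 E1].
    destruct (Hu1 e ltac:(lra)) as [m2 E2].
    { rewrite <- E. now apply (pair_map _ _ Pk). }
    exists (m2 - m1)%Z. rewrite E, E1, E2, Hlen, minus_IZR by exact Hx. ring.
Qed.

(** The drift coset is itself locally constant, hence invariant under [f^k], so every block of [k]
    iterations contributes the same amount. Comparison with [cell x] leaves finitely many drifts to
    consider. *)
Lemma drift_linear f h B A T cell pos len :
  iet_pair f h -> breaks_in f B -> chart f A T cell pos len ->
  exists k, (0 < k)%nat /\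
    (forall x n, I01 x -> exists m : Z,
       pos (Nat.iter (n * k) f x) - pos x =
       INR n * (pos (Nat.iter k f x) - pos x) + IZR m * len x) /\
    (forall x, I01 x -> len x = len (cell x) /\ exists m : Z,
       pos (Nat.iter k f x) - pos x =
       pos (Nat.iter k f (cell x)) - pos (cell x) + IZR m * len x).
Proof.
  intros P HB C.
  destruct (recurrence_power f h B A T cell pos len P HB C) as [k [Hk Hrec]].
  pose proof (Hrec R len (chart_len _ _ _ _ _ _ C)) as Hlen.
  pose proof (drift_locally_const f h B A T cell pos len k P HB C Hlen) as Hpsi.
  set (psi := fun x s => exists m : Z, s = pos (Nat.iter k f x) - pos x + IZR m * len x) in *.
  assert (Hself : forall x, psi x (pos (Nat.iter k f x) - pos x)).
  { intro x. exists 0%Z. ring. }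
  exists k. split; [exact Hk|]. split.
  - intros x n Hx.
    assert (Hinv : forall n, psi (Nat.iter (n * k) f x) = psi x /\
              len (Nat.iter (n * k) f x) = len x).
    { clear n. induction n as [|n [IH1 IH2]]; [split; reflexivity|].
      assert (HI : I01 (Nat.iter (n * k) f x))
        by now apply (pair_map _ _ (iet_pair_iter f h (n * k) P)).
      simpl. rewrite Nat.iter_add. split.
      - now rewrite (Hrec _ psi Hpsi).
      - now rewrite Hlen. }
    induction n as [|n [m IH]].
    + exists 0%Z. simpl. ring.
    + pose proof (Hself (Nat.iter (n * k) f x)) as Hs.
      rewrite (proj1 (Hinv n)) in Hs. destruct Hs as [m' Hs].
      exists (m + m')%Z. rewrite S_INR, plus_IZR. simpl. rewrite Nat.iter_add. lra.
  - intros x Hx. split; [apply (chart_const _ _ _ _ _ _ C R len); [apply C|exact Hx]|].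
    pose proof (Hself x) as Hs.
    rewrite (chart_const _ _ _ _ _ _ C _ psi Hpsi x Hx) in Hs. destruct Hs as [m Hs].
    exists m. rewrite (chart_const _ _ _ _ _ _ C R len (chart_len _ _ _ _ _ _ C) x Hx).
    exact Hs.
Qed.

(** * Rational drift implies finite order *)

Lemma multiples_finite (l D : R) :
  exists Z0, forall m : Z, Rabs (IZR m * l) <= D -> In (IZR m * l) Z0.
Proof.
  destruct (Req_dec l 0) as [->|Hl].
  - exists (0 :: nil). intros m _. left. ring.
  - destruct (archimed (D / Rabs l)) as [HK _]. set (K := up (D / Rabs l)) in *.
    exists (map (fun i => IZR (Z.of_nat i - K) * l) (seq 0 (Z.to_nat (2 * K + 1)))).
    intros m Hm. apply Rabs_pos_lt in Hl as Hl'. rewrite Rabs_mult in Hm.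
    assert (Hm' : Rabs (IZR m) < IZR K).
    { apply Rle_lt_trans with (D / Rabs l); [|exact HK].
      apply Rmult_le_reg_r with (Rabs l); [exact Hl'|].
      replace (D / Rabs l * Rabs l) with D by (field; lra). exact Hm. }
    rewrite <- abs_IZR in Hm'. apply lt_IZR in Hm'.
    apply in_map_iff. exists (Z.to_nat (m + K)). split.
    + do 2 f_equal. lia.
    + apply in_seq. lia.
Qed.

Lemma common_multiple (A : list R) (r l : R -> R) :
  (forall a, In a A -> exists (N : nat) (m : Z), (0 < N)%nat /\ INR N * r a = IZR m * l a) ->
  exists N : nat, (0 < N)%nat /\ forall a, In a A -> exists m : Z, INR N * r a = IZR m * l a.
Proof.
  induction A as [|c A IH]; intro H.
  - exists 1%nat. split; [lia|]. intros a [].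
  - destruct IH as [N [HN IH]]; [intros; apply H; now right|].
    destruct (H c (or_introl eq_refl)) as [N' [m' [HN' E']]].
    exists (N * N')%nat. split; [nia|]. intros a [<-|Ha].
    + exists (Z.of_nat N * m')%Z. rewrite mult_INR, mult_IZR, <- INR_IZR_INZ.
      rewrite Rmult_assoc, E'. ring.
    + destruct (IH a Ha) as [m E]. exists (Z.of_nat N' * m)%Z.
      rewrite mult_INR, mult_IZR, <- INR_IZR_INZ.
      replace (INR N * INR N' * r a) with (INR N' * (INR N * r a)) by ring. rewrite E. ring.
Qed.

(** Each point has a period at most [length Z0]; the factorial is a common multiple of all these
    periods. *)
Lemma finite_order_of_finite_displacements f h (Z0 : list R) :
  iet_pair f h -> (forall x j, I01 x -> In (Nat.iter j f x - x) Z0) ->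
  forall x, I01 x -> Nat.iter (fact (length Z0)) f x = x.
Proof.
  intros P H x Hx.
  destruct (pigeonhole (fun j => Nat.iter j f x - x) Z0) as [i [j [Hij E]]]; [auto|].
  assert (E' : Nat.iter (j - i) f x = x).
  { apply (iet_pair_inj _ _ _ _ (iet_pair_iter f h i P)); [|exact Hx|].
    - now apply (pair_map _ _ (iet_pair_iter f h (j - i) P)).
    - rewrite <- Nat.iter_add. replace (i + (j - i))%nat with j by lia. lra. }
  destruct (divide_fact (j - i) (length Z0)) as [q ->]; [lia|].
  rewrite iter_mul. now apply iter_fixed.
Qed.

(** For a common denominator [N], iterates of [f^(Nk)] change [pos] by integer multiples of [len].
    These changes are bounded, so finitely many multiples, and then finitely many displacements,
    occur. *)
Lemma finite_order_of_rational_drift f h A T cell pos len k :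
  iet_pair f h -> chart f A T cell pos len -> (0 < k)%nat ->
  (forall x n, I01 x -> exists m : Z,
     pos (Nat.iter (n * k) f x) - pos x =
     INR n * (pos (Nat.iter k f x) - pos x) + IZR m * len x) ->
  (forall x, I01 x -> len x = len (cell x) /\ exists m : Z,
     pos (Nat.iter k f x) - pos x =
     pos (Nat.iter k f (cell x)) - pos (cell x) + IZR m * len x) ->
  (forall x, I01 x -> exists (N : nat) (m : Z), (0 < N)%nat /\
     INR N * (pos (Nat.iter k f x) - pos x) = IZR m * len x) ->
  exists n, (0 < n)%nat /\ forall x, I01 x -> Nat.iter n f x = x.
Proof.
  intros P C Hk Hlin Hcell Hrat.
  destruct (list_sep R I01 A) as [A' [_ HA']].
  destruct (common_multiple A' (fun a => pos (Nat.iter k f a) - pos a) len) as [N [HN HN2]].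
  { intros a Ha. apply Hrat. now apply HA'. }
  assert (HcA : forall x, I01 x -> In (cell x) A').
  { intros x Hx. apply HA'. now apply (chart_cell _ _ _ _ _ _ C). }
  destruct (list_bound R (fun t r => Rabs t <= r) T) as [D [HD0 HD]].
  { intros; lra. } { intros t _. exists (Rabs t). lra. }
  (* [pos y - pos x] is within [D + D] of [y - x], which is below 1 in absolute value. *)
  destruct (list_union R R (fun a v => Rabs v <= 2 * D + 1 /\ exists m : Z, v = IZR m * len a) A')
    as [Zm HZm].
  { intros a _. destruct (multiples_finite (len a) (2 * D + 1)) as [Z0 HZ0].
    exists Z0. intros v [Hv [m ->]]. auto. }
  set (Z0 := map (fun p => fst p - fst (snd p) + snd (snd p)) (list_prod Zm (list_prod T T))).
  set (g := Nat.iter (N * k) f).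
  assert (Pg : iet_pair g (Nat.iter (N * k) h)) by now apply iet_pair_iter.
  exists (fact (length Z0) * (N * k))%nat.
  split; [pose proof (lt_O_fact (length Z0)); nia|].
  intros x Hx. rewrite iter_mul. fold g. revert x Hx.
  apply (finite_order_of_finite_displacements g (Nat.iter (N * k) h)); [exact Pg|].
  intros x j Hx. set (y := Nat.iter j g x).
  assert (Hy : I01 y) by now apply (pair_map _ _ (iet_pair_iter g _ j Pg)).
  pose proof (chart_shift _ _ _ _ _ _ C x Hx) as Tx.
  pose proof (chart_shift _ _ _ _ _ _ C y Hy) as Ty.
  unfold Z0. apply in_map_iff. exists (pos y - pos x, (pos y - y, pos x - x)).
  split; [simpl; ring|].
  apply in_prod; [|now apply in_prod].
  apply (HZm (cell x)); [now apply HcA|]. split.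
  - apply HD in Tx, Ty. destruct Hx as [Hx0 Hx1], Hy as [Hy0 Hy1]. apply Rabs_le.
    unfold Rabs in Tx, Ty.
    destruct (Rcase_abs (pos x - x)), (Rcase_abs (pos y - y)); lra.
  - destruct (Hlin x (j * N)%nat Hx) as [m1 E1].
    destruct (Hcell x Hx) as [El [m2 E2]].
    destruct (HN2 (cell x) (HcA x Hx)) as [m3 E3].
    exists (Z.of_nat j * m3 + Z.of_nat (j * N) * m2 + m1)%Z.
    rewrite !plus_IZR, !mult_IZR, <- !INR_IZR_INZ, <- El.
    rewrite <- El in E3.
    replace y with (Nat.iter (j * N * k) f x)
      by (unfold y, g; rewrite <- iter_mul; f_equal; lia).
    rewrite E1, E2, mult_INR.
    transitivity (INR j * (INR N * (pos (Nat.iter k f (cell x)) - pos (cell x))) +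
                  INR j * INR N * (IZR m2 * len x) + IZR m1 * len x); [ring|].
    rewrite E3. ring.
Qed.

(** * Additive functions on rational subspaces *)

Definition is_rational (q : R) : Prop :=
  exists p d : Z, d <> 0%Z /\ q = IZR p / IZR d.

Lemma is_rational_IZR (p : Z) : is_rational (IZR p).
Proof. exists p, 1%Z. split; [easy|]. field. Qed.

Lemma is_rational_plus q r : is_rational q -> is_rational r -> is_rational (q + r).
Proof.
  intros [p [d [Hd ->]]] [p' [d' [Hd' ->]]].
  exists (p * d' + p' * d)%Z, (d * d')%Z. split; [nia|].
  rewrite plus_IZR, !mult_IZR. field. split; now apply eq_IZR_contrapositive.
Qed.

Lemma is_rational_mult q r : is_rational q -> is_rational r -> is_rational (q * r).
Proof.
  intros [p [d [Hd ->]]] [p' [d' [Hd' ->]]].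
  exists (p * p')%Z, (d * d')%Z. split; [nia|].
  rewrite !mult_IZR. field. split; now apply eq_IZR_contrapositive.
Qed.

Lemma is_rational_inv q : is_rational q -> is_rational (/ q).
Proof.
  intros [p [d [Hd ->]]]. destruct (Z.eq_dec p 0) as [->|Hp].
  - exists 0%Z, 1%Z. split; [easy|]. unfold Rdiv. rewrite !Rmult_0_l. apply Rinv_0.
  - exists d, p. split; [exact Hp|]. field. split; now apply eq_IZR_contrapositive.
Qed.

(** [lam] is controlled only on a rational subspace [W], so finitely many one-dimensional extensions
    replace a Hamel basis. *)
Record additive_on (W : R -> Prop) (lam : R -> R) : Prop := {
  dom_plus : forall x y, W x -> W y -> W (x + y);
  dom_scale : forall q x, is_rational q -> W x -> W (q * x);
  lam_plus : forall x y, W x -> W y -> lam (x + y) = lam x + lam y }.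

Lemma dom_opp W lam x : additive_on W lam -> W x -> W (- x).
Proof.
  intros H Hx. replace (- x) with (IZR (-1) * x) by (simpl; ring).
  apply (dom_scale _ _ H); [apply is_rational_IZR|exact Hx].
Qed.

Lemma lam_opp W lam x : additive_on W lam -> W x -> lam (- x) = - lam x.
Proof.
  intros H Hx. pose proof (dom_opp _ _ _ H Hx) as Hnx.
  pose proof (dom_plus _ _ H _ _ Hx Hnx) as H0.
  pose proof (lam_plus _ _ H _ _ Hx Hnx) as E1. pose proof (lam_plus _ _ H _ _ H0 H0) as E2.
  rewrite Rplus_opp_r in *. rewrite Rplus_0_r in E2. lra.
Qed.

(** The formula [lam w + q * c] is well defined: two representations with different [q] would
    exhibit [v] as a rational multiple of an element of [W]. *)
Lemma additive_extend W lam v c :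
  W 0 -> additive_on W lam -> ~ W v ->
  exists W' lam', additive_on W' lam' /\
    forall w q, W w -> is_rational q -> W' (w + q * v) /\ lam' (w + q * v) = lam w + q * c.
Proof.
  intros H0 H Hv.
  assert (Huniq : forall w q w' q', W w -> is_rational q -> W w' -> is_rational q' ->
            w + q * v = w' + q' * v -> w = w' /\ q = q').
  { intros w q w' q' Hw Hq Hw' Hq' E. destruct (Req_dec q q') as [->|Hne]; [split; lra|].
    exfalso. apply Hv. replace v with (/ (q + IZR (-1) * q') * (w' + - w)).
    - apply (dom_scale _ _ H).
      + apply is_rational_inv, is_rational_plus; [exact Hq|].
        apply is_rational_mult; [apply is_rational_IZR|exact Hq'].
      + apply (dom_plus _ _ H); [exact Hw'|]. eapply dom_opp; eauto.
    - replace (w' + - w) with ((q - q') * v) by lra. simpl. field. lra. }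
  destruct (functional_choice (fun x z => forall w q, W w -> is_rational q -> x = w + q * v ->
              z = lam w + q * c)) as [lam' Hlam'].
  { intro x.
    destruct (classic (exists w q, W w /\ is_rational q /\ x = w + q * v))
      as [[w [q [Hw [Hq ->]]]]|Hn].
    - exists (lam w + q * c). intros w' q' Hw' Hq' E.
      destruct (Huniq w q w' q' Hw Hq Hw' Hq' E) as [-> ->]. reflexivity.
    - exists 0. intros w q Hw Hq E. exfalso. apply Hn. eauto. }
  exists (fun x => exists w q, W w /\ is_rational q /\ x = w + q * v), lam'. split.
  - constructor.
    + intros x y [w [q [Hw [Hq ->]]]] [w' [q' [Hw' [Hq' ->]]]].
      exists (w + w'), (q + q'). split; [now apply (dom_plus _ _ H)|].
      split; [now apply is_rational_plus|ring].
    + intros r x Hr [w [q [Hw [Hq ->]]]].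
      exists (r * w), (r * q). split; [now apply (dom_scale _ _ H)|].
      split; [now apply is_rational_mult|ring].
    + intros x y [w [q [Hw [Hq ->]]]] [w' [q' [Hw' [Hq' ->]]]].
      rewrite (Hlam' (w + q * v + (w' + q' * v)) (w + w') (q + q'));
        [|now apply (dom_plus _ _ H)|now apply is_rational_plus|ring].
      rewrite (Hlam' (w + q * v) w q), (Hlam' (w' + q' * v) w' q') by auto.
      rewrite (lam_plus _ _ H) by assumption. ring.
  - intros w q Hw Hq. split; [eauto|]. now apply Hlam'.
Qed.

Lemma additive_extend_list W lam (V : list R) :
  W 0 -> additive_on W lam ->
  exists W' lam', additive_on W' lam' /\ (forall v, In v V -> W' v) /\
    forall w, W w -> W' w /\ lam' w = lam w.
Proof.
  revert W lam. induction V as [|v V IH]; intros W lam H0 H.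
  - exists W, lam. split; [exact H|]. split; [intros v []|auto].
  - destruct (classic (W v)) as [Hv|Hv].
    + destruct (IH W lam H0 H) as [W' [lam' [H' [HV HW]]]].
      exists W', lam'. split; [exact H'|]. split; [|exact HW].
      intros u [<-|Hu]; [now apply HW|auto].
    + destruct (additive_extend W lam v 0 H0 H Hv) as [W1 [lam1 [H1 HW1]]].
      pose proof (is_rational_IZR 0) as R0. pose proof (is_rational_IZR 1) as R1.
      assert (HW1' : forall w, W w -> W1 w /\ lam1 w = lam w).
      { intros w Hw. destruct (HW1 w 0 Hw R0) as [Ha Hb].
        replace (w + 0 * v) with w in Ha, Hb by ring. split; [exact Ha|lra]. }
      assert (Hv1 : W1 v).
      { destruct (HW1 0 1 H0 R1) as [Ha _]. now replace (0 + 1 * v) with v in Ha by ring. }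
      destruct (IH W1 lam1 (proj1 (HW1' 0 H0)) H1) as [W' [lam' [H' [HV HW]]]].
      exists W', lam'. split; [exact H'|]. split.
      * intros u [<-|Hu]; [now apply HW|auto].
      * intros w Hw. destruct (HW1' w Hw) as [Ha Hb]. destruct (HW w Ha) as [Hc Hd].
        split; [exact Hc|congruence].
Qed.

(** Start with zero on the rational line through [l]. The hypothesis keeps [r] off that line, so [r]
    may be sent to 1; each vector of [V] still outside the domain is then sent to 0. For [l = 0] the
    hypothesis just says that [r] is not 0. *)
Lemma separating_functional (r l : R) (V : list R) :
  (forall (N : nat) (m : Z), (0 < N)%nat -> INR N * r <> IZR m * l) ->
  exists W lam, additive_on W lam /\ (forall v, In v V -> W v) /\
    forall (n : nat) (m : Z), W (INR n * r + IZR m * l) /\ lam (INR n * r + IZR m * l) = INR n.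
Proof.
  intro Hirr.
  set (W0 := fun x => exists q, is_rational q /\ x = q * l).
  assert (H0 : W0 0) by (exists 0; split; [apply is_rational_IZR|ring]).
  assert (HW0 : additive_on W0 (fun _ => 0)).
  { constructor.
    - intros x y [q [Hq ->]] [q' [Hq' ->]]. exists (q + q').
      split; [now apply is_rational_plus|ring].
    - intros s x Hs [q [Hq ->]]. exists (s * q). split; [now apply is_rational_mult|ring].
    - intros; ring. }
  assert (Hr : ~ W0 r).
  { intros [q [[p [d [Hd ->]]] E]].
    (* From [r = p / d * l], clear the denominator and move its sign to the other side, as [N] must
       be a positive natural number. *)
    apply (Hirr (Z.to_nat (Z.abs d)) (Z.sgn d * p)%Z); [lia|].
    rewrite INR_IZR_INZ, Z2Nat.id by lia.
    replace (Z.abs d) with (Z.sgn d * d)%Z by lia.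
    rewrite !mult_IZR, E. field. now apply eq_IZR_contrapositive. }
  destruct (additive_extend W0 (fun _ => 0) r 1 H0 HW0 Hr) as [W1 [lam1 [H1 HW1]]].
  assert (H10 : W1 0).
  { destruct (HW1 0 0 H0 (is_rational_IZR 0)) as [Ha _].
    now replace (0 + 0 * r) with 0 in Ha by ring. }
  destruct (additive_extend_list W1 lam1 V H10 H1) as [W [lam [H [HV HW]]]].
  exists W, lam. split; [exact H|]. split; [exact HV|]. intros n m.
  destruct (HW1 (IZR m * l) (INR n)) as [Ha Hb].
  { exists (IZR m). split; [apply is_rational_IZR|reflexivity]. }
  { rewrite INR_IZR_INZ. apply is_rational_IZR. }
  rewrite Rplus_comm. destruct (HW _ Ha) as [Hc Hd].
  split; [exact Hc|]. rewrite Hd, Hb. ring.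
Qed.

(** * The two subadditive bounds on words *)

Lemma iet_pair_ext f g h : eqI g f -> iet_pair f h -> iet_pair g h.
Proof.
  intros E P. constructor.
  - intros x Hx. rewrite E by exact Hx. now apply (pair_map _ _ P).
  - apply (pair_inv _ _ P).
  - intros x Hx. rewrite E by exact Hx. now apply (pair_hf _ _ P).
  - intros x Hx. rewrite E by (now apply (pair_inv _ _ P)). now apply (pair_fh _ _ P).
  - intros x Hx. destruct (pair_rf _ _ P x Hx) as [r [Hr H]].
    exists r. split; [exact Hr|]. intros e He. destruct (H e He) as [HI E'].
    now rewrite !E.
  - apply (pair_rh _ _ P).
Qed.

Lemma breaks_in_ext f g B : eqI g f -> breaks_in f B -> breaks_in g B.
Proof.
  intros E HB x Hx Hn. destruct (HB x Hx Hn) as [r [Hr H]].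
  exists r. split; [exact Hr|]. intros e He. destruct (H e He) as [HI E'].
  now rewrite !E.
Qed.

(** Passing to an inverse maps the break list forward, with the same length, and negates
    displacements. Hence bounds for the finitely many generators cover all letters. *)
Lemma letter_bounds (S : list (R -> R)) :
  (forall s, In s S -> is_IET s) ->
  exists (C : R) (V : list R), 0 <= C /\ forall g, letter S g ->
    (exists h B, iet_pair g h /\ breaks_in g B /\ INR (length B) <= C) /\
    (forall x, I01 x -> In (g x - x) V \/ In (- (g x - x)) V).
Proof.
  intro HS.
  destruct (list_bound (R -> R) (fun s r => exists h B, iet_pair s h /\ breaks_in s B /\
              INR (length B) <= r) S) as [C [HC0 HC]].
  { intros s r r' [h [B [P [HB H]]]] Hr. exists h, B. split; [exact P|]. split; [exact HB|lra]. }
  { intros s Hs. destruct (is_IET_pair s (HS s Hs)) as [h [B [P HB]]].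
    exists (INR (length B)), h, B. split; [exact P|]. split; [exact HB|lra]. }
  destruct (list_union (R -> R) R (fun s v => exists x, I01 x /\ v = s x - x) S) as [V HV].
  { intros s Hs. destruct (HC s Hs) as [h [B [P [HB _]]]].
    destruct (displacement_finite s B (pair_rf _ _ P) HB) as [V HV].
    exists V. intros v [x [Hx ->]]. auto. }
  exists C, V. split; [exact HC0|]. intros g [s [Hs Hg]].
  destruct (HC s Hs) as [h [B [P [HB HBC]]]].
  destruct Hg as [E|Hinv].
  - split.
    + exists h, B. split; [eapply iet_pair_ext; eauto|]. split; [eapply breaks_in_ext; eauto|easy].
    + intros x Hx. left. rewrite E by exact Hx. apply (HV s); eauto.
  - assert (E : eqI g h).
    { intros x Hx. destruct (Hinv x Hx) as [Hgx [E _]].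
      rewrite <- E at 2. symmetry. now apply (pair_hf _ _ P). }
    split.
    + exists s, (map s B). split; [|split].
      * apply (iet_pair_ext h); [exact E|now apply iet_pair_sym].
      * apply (breaks_in_ext h); [exact E|]. now apply breaks_in_inv.
      * now rewrite length_map.
    + intros x Hx. destruct (Hinv x Hx) as [Hgx [E' _]]. right.
      apply (HV s); [exact Hs|]. exists (g x). split; [exact Hgx|]. rewrite E'. ring.
Qed.

(** The summand 1 is the break of the identity at 0, carried by the empty word. *)
Lemma word_breaks (S : list (R -> R)) (C : R) (w : list (R -> R)) :
  (forall g, letter S g -> exists h B, iet_pair g h /\ breaks_in g B /\ INR (length B) <= C) ->
  Forall (letter S) w ->
  exists h B, iet_pair (eval_word w) h /\ breaks_in (eval_word w) B /\
    INR (length B) <= 1 + C * INR (length w).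
Proof.
  intros HC Hw. induction Hw as [|g w Hg Hw [h [B [P [HB Hlen]]]]].
  - exists (fun x => x), (0 :: nil). split; [exact iet_pair_id|].
    split; [exact breaks_in_id|simpl; lra].
  - destruct (HC g Hg) as [k [D [Pg [HD HDlen]]]].
    exists (fun x => h (k x)), (B ++ map h D). split; [exact (iet_pair_comp _ _ _ _ P Pg)|].
    split; [exact (breaks_in_comp _ h g B D P HB HD)|].
    rewrite length_app, length_map, plus_INR.
    change (length (g :: w)) with (Datatypes.S (length w)). rewrite S_INR. lra.
Qed.

Lemma word_displacement (S : list (R -> R)) (W : R -> Prop) (lam : R -> R) (C : R) w x :
  additive_on W lam -> W 0 ->
  (forall g, letter S g -> forall x, I01 x -> I01 (g x)) ->
  (forall g, letter S g -> forall x, I01 x -> W (g x - x) /\ Rabs (lam (g x - x)) <= C) ->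
  Forall (letter S) w -> I01 x ->
  I01 (eval_word w x) /\ W (eval_word w x - x) /\
  Rabs (lam (eval_word w x - x)) <= C * INR (length w).
Proof.
  intros H H0 Hm Hd Hw Hx. induction Hw as [|g w Hg Hw [IH1 [IH2 IH3]]].
  - simpl. rewrite Rminus_diag. split; [exact Hx|]. split; [exact H0|].
    pose proof (lam_plus _ _ H 0 0 H0 H0) as E. rewrite Rplus_0_r in E.
    replace (lam 0) with 0 by lra. rewrite Rabs_R0. lra.
  - change (length (g :: w)) with (Datatypes.S (length w)). rewrite S_INR.
    simpl eval_word. set (y := eval_word w x) in *.
    destruct (Hd g Hg y IH1) as [Hd1 Hd2].
    split; [now apply (Hm g Hg)|].
    replace (g y - x) with ((g y - y) + (y - x)) by ring.
    split; [now apply (dom_plus _ _ H)|].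
    rewrite (lam_plus _ _ H) by assumption.
    pose proof (Rabs_triang (lam (g y - y)) (lam (y - x))). lra.
Qed.

(** * The contradiction *)

(** Otherwise all drifts would be rational and [f] would have finite order. The case [l = 0], a
    nonzero drift on an arc, is not treated apart: it counts as irrational and is refuted together
    with the circles. *)
Lemma irrational_drift f h B A T cell pos len :
  iet_pair f h -> breaks_in f B -> chart f A T cell pos len -> infinite_order f ->
  exists (k : nat) (a r l : R), I01 a /\
    (forall (N : nat) (m : Z), (0 < N)%nat -> INR N * r <> IZR m * l) /\
    forall n, exists m : Z, pos (Nat.iter (n * k) f a) - pos a = INR n * r + IZR m * l.
Proof.
  intros P HB C Hinf.
  destruct (drift_linear f h B A T cell pos len P HB C) as [k [Hk [Hlin Hcell]]].
  apply NNPP. intro Hn.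
  destruct (finite_order_of_rational_drift f h A T cell pos len k P C Hk Hlin Hcell)
    as [n [Hn0 Hid]]; [|now apply (Hinf n)].
  intros x Hx. apply NNPP. intro Hirr. apply Hn.
  exists k, x, (pos (Nat.iter k f x) - pos x), (len x).
  split; [exact Hx|]. split.
  - intros N m HN E. apply Hirr. eauto.
  - intro n. now apply Hlin.
Qed.

Lemma few_breaks_of_distortion S f C :
  0 <= C ->
  (forall g, letter S g -> exists h B, iet_pair g h /\ breaks_in g B /\ INR (length B) <= C) ->
  (forall eps, 0 < eps -> forall N : nat, exists n : nat, (N <= n)%nat /\
     exists k : nat, word_len_le S (fpow f n) k /\ INR k < eps * INR n) ->
  forall M, exists n D, breaks_in (Nat.iter n f) D /\ (length D + M < n)%nat.
Proof.
  intros HC0 HC Hdist M.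
  (* This epsilon leaves at most [1 + n/2] breaks for [f^n], and [n >= 2M + 3] gives
     [1 + n/2 + M < n]. Adding 1 to [C] keeps the denominator positive. *)
  destruct (Hdist (/ (2 * (C + 1))) ltac:(apply Rinv_0_lt_compat; lra) (2 * M + 3)%nat)
    as [n [Hn [k [[w [Hwk [Hw Heq]]] Hk]]]].
  destruct (word_breaks S C w HC Hw) as [h [D [_ [HD Hlen]]]].
  exists n, D. split.
  - apply (breaks_in_ext (eval_word w)); [|exact HD]. intros x Hx. now rewrite Heq.
  - apply INR_lt. rewrite plus_INR. apply le_INR in Hwk, Hn.
    rewrite plus_INR, mult_INR in Hn. simpl in Hn.
    assert (Hk2 : C * INR (length w) <= INR n / 2).
    { apply Rle_trans with ((C + 1) * INR k).
      - apply Rmult_le_compat; try lra. apply pos_INR.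
      - apply (Rmult_lt_compat_l (C + 1)) in Hk; [|lra].
        replace ((C + 1) * (/ (2 * (C + 1)) * INR n)) with (INR n / 2) in Hk by (field; lra).
        lra. }
    lra.
Qed.

Theorem theorem1p3 : forall f : R -> R, is_IET f -> ~ distortion_in_E f.
Proof.
  intros f Hf [S [HS [_ [Hinf Hdist]]]].
  destruct (is_IET_pair f Hf) as [h [B [P HB]]].
  destruct (letter_bounds S HS) as [C [V [HC0 HCV]]].
  destruct (glued_self_off_list f h B P HB) as [Q HQ].
  { apply (few_breaks_of_distortion S f C HC0); [|exact Hdist]. intros g Hg. now apply HCV. }
  destruct (chart_exists f h Q P HQ) as [A [T [cell [pos [len Hch]]]]].
  destruct (irrational_drift f h B A T cell pos len P HB Hch Hinf)
    as [k [a [r [l [Ha [Hirr Hdrift]]]]]].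
  (* [lam] is needed on the displacements of generators, in [V], and on the values of [pos x - x],
     in [T]. *)
  destruct (separating_functional r l (V ++ T) Hirr) as [W [lam [Hadd [HW Hlam]]]].
  assert (HW0 : W 0).
  { destruct (Hlam 0%nat 0%Z) as [H0 _].
    now replace (INR 0 * r + 0 * l) with 0 in H0 by (simpl; ring). }
  destruct (list_bound R (fun v c => Rabs (lam v) <= c) (V ++ T)) as [K [HK0 HK]].
  { intros; lra. } { intros v _. exists (Rabs (lam v)). lra. }
  assert (Hword : forall w x, Forall (letter S) w -> I01 x ->
            I01 (eval_word w x) /\ W (eval_word w x - x) /\
            Rabs (lam (eval_word w x - x)) <= K * INR (length w)).
  { intros w x Hw Hx. apply (word_displacement S); auto.
    - intros g Hg. destruct (HCV g Hg) as [[h' [B' [P' _]]] _]. apply (pair_map _ _ P').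
    - intros g Hg y Hy.
      destruct (proj2 (HCV g Hg) y Hy) as [Hi|Hi];
        assert (Hi' := in_or_app V T _ (or_introl Hi)).
      + split; [now apply HW|now apply HK].
      + replace (g y - y) with (- - (g y - y)) by ring.
        split; [eapply dom_opp; eauto|].
        rewrite (lam_opp W lam) by auto. rewrite Rabs_Ropp. now apply HK. }
  (* Using the word for [f^n] in total [k] times bounds [lam (f^(kn) a - a)] by [n/2], while the
     drift makes it at least [n - 2K]. The threshold on [n] excludes the resulting [n <= 4K]. *)
  destruct (Hdist (/ (2 * (INR k * K + 1)))) with (N := Z.to_nat (up (4 * K + 1)))
    as [n [Hn [j [[w [Hwj [Hw Heq]]] Hj]]]].
  { apply Rinv_0_lt_compat. pose proof (pos_INR k). nra. }
  assert (Hpow : forall q, W (Nat.iter (q * n) f a - a) /\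
            Rabs (lam (Nat.iter (q * n) f a - a)) <= INR q * (K * INR (length w))).
  { induction q as [|q [IH1 IH2]].
    - simpl. rewrite Rminus_diag. split; [exact HW0|].
      pose proof (lam_plus _ _ Hadd 0 0 HW0 HW0) as E. rewrite Rplus_0_r in E.
      replace (lam 0) with 0 by lra. rewrite Rabs_R0. lra.
    - set (y := Nat.iter (q * n) f a) in *.
      assert (Hy : I01 y) by now apply (pair_map _ _ (iet_pair_iter f h (q * n) P)).
      destruct (Hword w y Hw Hy) as [_ [Hd1 Hd2]].
      rewrite (Heq y Hy) in Hd1, Hd2. unfold fpow in Hd1, Hd2.
      simpl Nat.mul. rewrite Nat.iter_add. fold y. rewrite S_INR.
      replace (Nat.iter n f y - a) with ((Nat.iter n f y - y) + (y - a)) by ring.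
      split; [now apply (dom_plus _ _ Hadd)|].
      rewrite (lam_plus _ _ Hadd) by assumption.
      pose proof (Rabs_triang (lam (Nat.iter n f y - y)) (lam (y - a))). lra. }
  destruct (Hpow k) as [_ Hup]. rewrite Nat.mul_comm in Hup.
  destruct (Hdrift n) as [m Hm]. set (y := Nat.iter (n * k) f a) in *.
  assert (Hy : I01 y) by now apply (pair_map _ _ (iet_pair_iter f h (n * k) P)).
  destruct (Hlam n m) as [Hl1 Hl2]. rewrite <- Hm in Hl1, Hl2.
  assert (Ty := in_or_app V T _ (or_intror (chart_shift _ _ _ _ _ _ Hch y Hy))).
  assert (Ta := in_or_app V T _ (or_intror (chart_shift _ _ _ _ _ _ Hch a Ha))).
  (* Passing from [pos] back to the points themselves costs one value from [T] at each end, at most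
     [K] apiece. *)
  assert (E : lam (y - a) = INR n - lam (pos y - y) + lam (pos a - a)).
  { replace (y - a) with ((pos y - pos a) + (- (pos y - y) + (pos a - a))) by ring.
    assert (W (- (pos y - y))) by (eapply dom_opp; eauto).
    rewrite (lam_plus _ _ Hadd); [|exact Hl1|apply (dom_plus _ _ Hadd); auto].
    rewrite (lam_plus _ _ Hadd), (lam_opp W lam), Hl2; auto. ring. }
  apply HK in Ty, Ta.
  assert (HnK : 4 * K + 1 < INR n).
  { apply Rlt_le_trans with (IZR (up (4 * K + 1))); [apply archimed|].
    apply le_INR in Hn. eapply Rle_trans; [|exact Hn].
    rewrite INR_IZR_INZ. apply IZR_le. lia. }
  assert (Hsmall : INR k * (K * INR (length w)) <= INR n / 2).
  { apply le_INR in Hwj. pose proof (pos_INR k) as Hk0.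
    assert (0 <= INR k * K) by (apply Rmult_le_pos; lra).
    apply Rle_trans with ((INR k * K + 1) * INR j).
    - rewrite <- Rmult_assoc. apply Rmult_le_compat; try lra. apply pos_INR.
    - apply (Rmult_lt_compat_l (INR k * K + 1)) in Hj; [|lra].
      replace ((INR k * K + 1) * (/ (2 * (INR k * K + 1)) * INR n)) with (INR n / 2) in Hj
        by (field; lra).
      lra. }
  pose proof (Rle_abs (lam (y - a))). pose proof (Rle_abs (lam (pos y - y))).
  pose proof (Rle_abs (- lam (pos a - a))) as Hneg. rewrite Rabs_Ropp in Hneg. lra.
Qed.
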